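(* Let $I,J\subseteq N$ with $|I|=|J|=k$, and put $r=q-k$. Then the minor of the superport response matrix $L$ with rows $I$ and columns $J$ satisfies $$\det L[I,J]=\frac{1}{\Phi_{\mathrm{valid}}}\sum_{F\in\mathcal F_{r+1}}\widehat\chi_F(I)\,\widehat\chi_F(J)\,w(F).$$ For every forest $F\in\mathcal F_{r+1}$, $$\alpha_F(I,J):=\widehat\chi_F(I)\,\widehat\chi_F(J)\in\{0,+1,-1\}.$$ The coefficient $\alpha_F(I,J)$ is nonzero exactly when both complementary port-edge sets $N\setminus I$ and $N\setminus J$ are spanning trees of $H_F$.
   Context: Network. $G=(V,E)$ is a finite connected simple undirected graph; each edge $e$ has a conductance $c_e\in\mathbb R_{>0}$. The weighted Laplacian $L_c$ is the $V\times V$ matrix with $(L_c)_{uu}=\sum_{e\ni u}c_e$, $(L_c)_{uv}=-c_{uv}$ if $uv\in E$, and $0$ otherwise. A spanning forest $F$ of $G$ is an acyclic subgraph with vertex set $V$ (isolated vertices allowed); $w(F)=\prod_{e\in F}c_e$; $\mathcal F_m$ is the set of spanning forests with exactly $m$ connected components. Matrix conventions. $A[S,T]$ is the submatrix with rows $S$ and columns $T$ in inherited order; empty determinants equal $1$. Superports. The boundary $M\subseteq V$ is nonempty and partitioned into nonempty superports $M=A_1\sqcup\cdots\sqcup A_p$. Choose a root $r_a\in A_a$ for each $a$; $R=\{r_1,\dots,r_p\}$, $N=M\setminus R$, $q=|N|$, $N=(x_1,\dots,x_q)$ in a fixed order; $r(x)$ is the root of the superport containing $x$. Fix a ground root $g\in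 R$. In $\mathbb R^{V\setminus\{g\}}$ with standard basis $(e_v)$ and the convention $e_g=0$, let $D$ be the matrix whose columns are $d_x=e_x-e_{r(x)}$, $x\in N$, in the fixed order. Superport response. Given $y\in\mathbb R^N$, consider voltages $U\in\mathbb R^V$ with $U_x-U_{r(x)}=y_x$ for all $x\in N$ whose incoming-current vector $\iota=L_cU$ satisfies $\iota_v=0$ for $v\notin M$ and $\sum_{v\in A_a}\iota_v=0$ for every $a$. Put $j_x=\iota_x$ for $x\in N$ (the independent incoming currents). The linear map $y\mapsto j$ is the superport response and $L$ is its $q\times q$ matrix: $j=Ly$. Valid forests. A spanning forest is valid if identifying all boundary vertices within each superport (one vertex per superport) turns it into a spanning tree of the quotient network (loops and parallel edges count as cycles). $\Phi_{\mathrm{valid}}=\sum_{F\text{ valid}}w(F)$. Quotient port graph. For a spanning forest $F$ with $s\ge1$ components, let $C_0(F)$ be the component containing $g$ and order the others as $C_1(F),\dots,C_{s-1}(F)$. The quotient port multigraph $H_F$ has the components of $F$ as vertices, and each $x\in N$ gives a directed edge from the component containing $r(x)$ to the component containing $x$ (a loop if these coincide). Let $Q_F$ be the $(s-1)\times(|V|-1)$ matrix with columns indexed by $V\setminus\{g\}$ and $(Q_F)_{a,v}=1$ if $v\in C_a(F)$, $0$ otherwise ($1\le a\le s-1$), and $B_F=Q_FD$. Completed determinant. For $I\subseteq N$, $|I|=k$, let $E_I$ be the $q\times k$ matrix whose columns are the standard basis vectors of $\mathbb R^N$ indexed by $I$, in inherited order. For $F\in\mathcal F_{q-k+1}$, $\widehat\chi_F(I)=\det\begin{pmatrix}B_F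 \\ E_I^T\end{pmatrix}$, a $q\times q$ determinant. *)

(* Defs.v *)
From mathcomp Require Import all_boot all_order all_algebra.

Set Implicit Arguments.
Unset Strict Implicit.
Unset Printing Implicit Defensive.

Import Order.TTheory GRing.Theory Num.Theory.
Local Open Scope ring_scope.

(* Undirected multigraphs on a vertex set inside [W], with edges labelled by
   [E]; [mg_joins] is meant to be symmetric, and [mg_joins e u u] says that [e]
   is a loop at [u]. *)
Record multigraph (W E : finType) := Multigraph {
  mg_verts : {set W};
  mg_joins : E -> rel W }.

Section Multigraph.
Variables (W E : finType) (H : multigraph W E).
Implicit Types (T : {set E}) (s : seq (W * E)).

Definition mg_adj T : rel W := fun u v =>
  [&& u \in mg_verts H, v \in mg_verts H & [exists e in T, mg_joins H e u v]].

Definition mg_connected T : bool :=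
  [forall u in mg_verts H, forall v in mg_verts H, connect (mg_adj T) u v].

(* [:: (v_1, e_1); ...; (v_n, e_n)] with n >= 1, the v_i distinct, the e_i
   distinct, e_i joining v_i to v_(i+1) and e_n joining v_n to v_1: a loop is
   a cycle of length 1, two parallel edges form a cycle of length 2. *)
Definition mg_cycle T s : bool :=
  [&& s != [::],
      all (fun z => (z.1 \in mg_verts H) && (z.2 \in T)) s,
      uniq (unzip1 s), uniq (unzip2 s)
    & cycle (fun z z' => mg_joins H z.2 z.1 z'.1) s].

(* The length bound only serves to make the predicate boolean; it loses
   nothing, see [mg_acyclicP]. *)
Definition mg_acyclic T : bool :=
  [forall n : 'I_#|E|.+1, forall s : n.-tuple (W * E), ~~ mg_cycle T s].

Lemma mg_acyclicP T : reflect (forall s, ~~ mg_cycle T s) (mg_acyclic T).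
Proof.
apply: (iffP forallP) => [acT s | acT n]; last by apply/forallP.
apply/negP => cs; have /and5P[_ _ _ us _] := cs.
have les : (size s < #|E|.+1)%N.
  by rewrite ltnS -(size_map snd s) -(card_uniqP us) max_card.
by have /forallP/(_ (in_tuple s))/negP := acT (Ordinal les); apply.
Qed.

Definition mg_spanning_tree T : bool := mg_connected T && mg_acyclic T.

End Multigraph.

(* A simple graph on [V] is given by its set [G] of edges, which are
   two-element subsets of [V]. *)
Section Forests.
Variables (R : realFieldType) (V : finType).
Implicit Types (G F : {set {set V}}) (P : {set {set V}}) (c : {set V} -> R).

Definition simple_graph G : Prop := {in G, forall e : {set V}, #|e| = 2%N}.

Definition graph_mg : multigraph V {set V} :=
  Multigraph [set: V] (fun e u v => e == [set u; v]).

(* The multigraph obtained by contracting each block of a partition [P]. *)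
Definition quotient_mg P : multigraph {set V} {set V} :=
  Multigraph P (fun e B B' =>
    [exists u in B, exists v in B', e == [set u; v]]).

Definition components F : {set {set V}} :=
  equivalence_partition (connect (mg_adj graph_mg F)) [set: V].

Definition spanning_forest G F : bool :=
  (F \subset G) && mg_acyclic graph_mg F.

Definition forests G (m : nat) : {set {set {set V}}} :=
  [set F | spanning_forest G F & #|components F| == m].

Definition weight c F : R := \prod_(e in F) c e.

Definition laplacian G c (u v : V) : R :=
  if u == v then \sum_(e in G | u \in e) c e
  else if [set u; v] \in G then - c [set u; v] else 0.

Definition current G c (U : V -> R) (v : V) : R :=
  \sum_u laplacian G c v u * U u.

End Forests.

(* Superports [A a] with roots [rt a]; [x] enumerates the non-root boundary
   vertices. *)
Section Superports.
Variables (R : realFieldType) (V : finType) (G : {set {set V}}).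
Variables (c : {set V} -> R) (p q : nat).
Variables (A : 'I_p -> {set V}) (rt : 'I_p -> V) (x : 'I_q -> V) (g : V).

Definition boundary : {set V} := \bigcup_a A a.

Definition port_roots : {set V} := [set rt a | a : 'I_p].

(* The default value, for [v] outside the boundary, is never used. *)
Definition root_of (v : V) : V :=
  if [pick a | v \in A a] is Some a then rt a else v.

Definition port_blocks : {set {set V}} :=
  [set A a | a : 'I_p] :|: [set [set v] | v in ~: boundary].

Definition valid_forest (F : {set {set V}}) : bool :=
  spanning_forest G F && mg_spanning_tree (quotient_mg port_blocks) F.

Definition Phi_valid : R := \sum_(F | valid_forest F) weight c F.

Definition admissible (y : 'cV[R]_q) (U : V -> R) : Prop :=
  [/\ forall i, U (x i) - U (root_of (x i)) = y i 0,
      forall v, v \notin boundary -> current G c U v = 0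
    & forall a, \sum_(v in A a) current G c U v = 0].

(* The relation between port voltages and independent currents is the graph
   of y |-> L y. *)
Definition superport_response (L : 'M[R]_q) : Prop :=
  forall y j : 'cV[R]_q,
    (exists2 U, admissible y U & j = \col_i current G c U (x i))
    <-> j = L *m y.

(* C ord0, C 1, ..., C m are the components of [F], that of [g] first. *)
Definition component_order (F : {set {set V}}) m (C : 'I_m.+1 -> {set V}) :=
  [/\ injective C, [set C a | a : 'I_m.+1] = components F & g \in C ord0].

(* Rows (of D) or columns (of Q) are indexed by V \ {g} through [enum_val];
   row g being absent, e_g = 0. *)
Definition portD : 'M[R]_(#|[set~ g]|, q) :=
  \matrix_(v, i) ((enum_val v == x i)%:R - (enum_val v == root_of (x i))%:R).

Definition compQ m (C : 'I_m.+1 -> {set V}) : 'M[R]_(m, #|[set~ g]|) :=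
  \matrix_(a, v) (enum_val v \in C (lift ord0 a))%:R.

Definition compB m (C : 'I_m.+1 -> {set V}) : 'M[R]_(m, q) := compQ C *m portD.

Definition H_tail (F : {set {set V}}) (i : 'I_q) : {set V} :=
  pblock (components F) (root_of (x i)).

Definition H_head (F : {set {set V}}) (i : 'I_q) : {set V} :=
  pblock (components F) (x i).

Definition quotient_port_graph (F : {set {set V}}) : multigraph {set V} 'I_q :=
  Multigraph (components F) (fun i B B' =>
    ((B == H_tail F i) && (B' == H_head F i))
    || ((B == H_head F i) && (B' == H_tail F i))).

End Superports.

Section CompletedDeterminant.
Variables (R : realFieldType) (q k : nat).
Implicit Types (I J : {set 'I_q}).

(* The elements of [I] in increasing order. *)
Definition elt I (hI : #|I| = k) (b : 'I_k) : 'I_q :=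
  enum_val (cast_ord (esym hI) b).

Definition minor (L : 'M[R]_q) I J (hI : #|I| = k) (hJ : #|J| = k) : R :=
  \det (mxsub (elt hI) (elt hJ) L).

Definition selE I (hI : #|I| = k) : 'M[R]_(q, k) :=
  \matrix_(i, b) (i == elt hI b)%:R.

Lemma compl_dim I : #|I| = k -> (q - k + k)%N = q.
Proof. by move=> <-; rewrite subnK // -[leqRHS]card_ord max_card. Qed.

Definition stack_det (B : 'M[R]_(q - k, q)) I (hI : #|I| = k) : R :=
  \det (castmx (compl_dim hI, erefl q) (col_mx B (selE hI)^T)).

End CompletedDeterminant.

Section Chi.
Variables (R : realFieldType) (V : finType) (p q k : nat).
Variables (A : 'I_p -> {set V}) (rt : 'I_p -> V) (x : 'I_q -> V) (g : V).

Definition chi_hat (C : 'I_(q - k).+1 -> {set V}) (I : {set 'I_q})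
    (hI : #|I| = k) : R :=
  stack_det (compB R A rt x g C) hI.

Definition alpha (C : 'I_(q - k).+1 -> {set V}) (I J : {set 'I_q})
    (hI : #|I| = k) (hJ : #|J| = k) : R :=
  chi_hat C hI * chi_hat C hJ.

End Chi.

(* Main.v *)
Require Import Defs.
From mathcomp Require Import all_boot all_order fingroup perm all_algebra.

Set Implicit Arguments.
Unset Strict Implicit.
Unset Printing Implicit Defensive.

Import Order.TTheory GRing.Theory Num.Theory.
Local Open Scope ring_scope.

(* Use as coordinates the block voltages [U_w - U_g], [w] the root of a block not
   containing [g], followed by the port voltages [U_x - U_(r(x))].  In the dual basis
   the reduced Laplacian is [[a, b], [b^T, d]], where [a] is the Laplacian of
   the network with contracted superports, and the response matrix is the Schur
   complement [L = d - b^T a^-1 b].  Hence [det a * det L[I, J]] is a minor of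
   that matrix, which by Cauchy-Binet is a sum over edge sets [F] of
   [w(F) det (Psi_I N_F) det (Psi_J N_F)], with [N_F] the reduced incidence matrix
   and [Psi_I] the rows "blocks, ports in I" of the change of coordinates.  The
   term vanishes unless [F] is a forest with [r + 1] components.  For such [F]
   the determinant of the rows [Psi_I] and [Q_F] is, up to signs independent
   of [I], both [det (Psi_I N_F)] and the completed determinant.  All signs come from
   the total unimodularity of reduced incidence matrices, which also turns [det a]
   into [Phi_valid] and makes the completed determinants 0, 1 or -1; a
   square reduced incidence matrix is invertible exactly for spanning trees. *)

(** * Determinants *)

Section Determinants.
Variable R : realFieldType.

(** The sign is the product of the signs of [f] and [g]. It is chosen before the matrix, so one
    [eps] serves for several matrices and cancels through [eps ^+ 2 = 1]. *)
Lemma det_mxsub_perm n (f g : 'I_n -> 'I_n) :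
  injective f -> injective g ->
  exists2 eps : R, eps ^+ 2 = 1
    & forall A : 'M[R]_n, \det (mxsub f g A) = eps * \det A.
Proof.
move=> fI gI; exists ((-1) ^+ perm fI * (-1) ^+ perm gI).
  by rewrite exprMn !sqrr_sign mulr1.
move=> A; have -> : mxsub f g A = perm_mx (perm fI) *m (A *m (perm_mx (perm gI))^T).
  rewrite tr_perm_mx -col_permE -row_permE; apply/matrixP => i j.
  by rewrite !mxE !permE.
by rewrite !det_mulmx det_tr !det_perm [\det A * _]mulrC mulrA.
Qed.

(** A propositional [m = n] lets index types such as ['I_(r + (m + k))] and ['I_(m + (r + k))] be
    matched without casting the matrix. *)
Lemma det_mxsub_inj m n (f g : 'I_m -> 'I_n) :
  injective f -> injective g -> m = n ->
  exists2 eps : R, eps ^+ 2 = 1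
    & forall A : 'M[R]_n, \det (mxsub f g A) = eps * \det A.
Proof. by move=> + + e; case: n / e f g => f g; apply: det_mxsub_perm. Qed.

(** * The Cauchy-Binet formula for weighted sums of rank-one matrices *)

Section CauchyBinet.
Variables (T : finType) (t0 : T) (m : nat) (c : T -> R) (u v : T -> 'cV[R]_m).

Let U (f : 'I_m -> T) : 'M[R]_m := \matrix_(i, j) u (f j) i 0.
Let W (f : 'I_m -> T) : 'M[R]_m := \matrix_(i, j) v (f j) i 0.

Let det_comp_perm (w : T -> 'cV[R]_m) (f : 'I_m -> T) (s : 'S_m) :
  \det (\matrix_(i, j) w (f (s j)) i 0) =
  (-1) ^+ s * \det (\matrix_(i, j) w (f j) i 0) :> R.
Proof.
rewrite -det_perm -[\det (perm_mx s)]det_tr mulrC -det_mulmx tr_perm_mx -col_permE.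
by congr (\det _); apply/matrixP => i j; rewrite !mxE.
Qed.

(** In the Leibniz formula, [f i] is the rank-one term chosen for row [i]; for fixed [f] the sum
    over permutations reassembles to [\det (W f)]. *)
Let det_sum_ffun :
  \det (\sum_t c t *: (u t *m (v t)^T)) =
  \sum_(f : {ffun 'I_m -> T}) \prod_i c (f i) * \prod_i u (f i) i 0 * \det (W f).
Proof.
transitivity (\sum_(s : 'S_m) (-1) ^+ s *
    \sum_(f : {ffun 'I_m -> T}) \prod_i (c (f i) * u (f i) i 0 * v (f i) (s i) 0)).
  apply: eq_bigr => s _; congr (_ * _).
  rewrite -(bigA_distr_bigA (fun i t => c t * u t i 0 * v t (s i) 0)) /=.
  apply: eq_bigr => i _; rewrite summxE; apply: eq_bigr => t _.
  by rewrite !mxE big_ord1 !mxE mulrA.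
under eq_bigr do rewrite big_distrr /=.
rewrite exchange_big /=; apply: eq_bigr => f _.
rewrite -det_tr /determinant big_distrr /=; apply: eq_bigr => s _.
rewrite mulrCA; congr (_ * _); rewrite !big_split /=; congr (_ * _).
by apply: eq_bigr => i _; rewrite !mxE.
Qed.

(** [det_sum_ffun] is summed once for each permutation [s], after replacing [f] by [f \o s]. Then
    [\det (W f)] contributes the sign of [s], which completes the products of entries of [u] to
    [\det (U f)]. *)
Let fact_det_sum :
  m`!%:R * \det (\sum_t c t *: (u t *m (v t)^T)) =
  \sum_(f : {ffun 'I_m -> T}) \prod_i c (f i) * \det (U f) * \det (W f).
Proof.
transitivity (\sum_(s : 'S_m) \sum_(f : {ffun 'I_m -> T})
   \prod_i c (f i) * ((-1) ^+ s * \prod_i u (f (s i)) i 0) * \det (W f)).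
  rewrite det_sum_ffun -card_Sn -sum1_card natr_sum big_distrl /=.
  apply: eq_big => [s|s _]; first by rewrite inE.
  have inj_s : injective (fun f : {ffun 'I_m -> T} => [ffun i => f (s i)]).
    move=> f h /ffunP fh; apply/ffunP => i; have := fh (s^-1 i)%g.
    by rewrite !ffunE permKV.
  rewrite mul1r (reindex_inj inj_s); apply: eq_bigr => f _.
  have -> : \prod_i c ([ffun i => f (s i)] i) = \prod_i c (f i).
    by rewrite [RHS](reindex_inj (@perm_inj _ s)); apply: eq_bigr => i _; rewrite ffunE.
  have -> : \det (W [ffun i => f (s i)]) = (-1) ^+ s * \det (W f).
    rewrite -det_comp_perm; congr (\det _); apply/matrixP=> i j.
    by rewrite !mxE ffunE.
  rewrite -!mulrA; congr (_ * _); rewrite mulrCA; congr (_ * (_ * _)).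
  by apply: eq_bigr => i _; rewrite ffunE.
rewrite exchange_big /=; apply: eq_bigr => f _; rewrite -big_distrl -big_distrr /=.
congr (_ * _ * _).
by apply: eq_bigr => s _; congr (_ * _); apply: eq_bigr => i _; rewrite !mxE.
Qed.

(** A map [f] that is not injective repeats a column. An [m]-subset [F] is the image of [m!]
    injective maps, each differing from [enum F] by a permutation whose sign occurs in both
    determinants. *)
Lemma Cauchy_Binet :
  \det (\sum_t c t *: (u t *m (v t)^T)) =
  \sum_(F : {set T} | #|F| == m) \prod_(t in F) c t
     * \det (\matrix_(i < m, j < m) u (nth t0 (enum F) j) i 0)
     * \det (\matrix_(i < m, j < m) v (nth t0 (enum F) j) i 0).
Proof.
have m0 : m`!%:R != 0 :> R by rewrite pnatr_eq0 -lt0n fact_gt0.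
apply: (mulfI m0); rewrite fact_det_sum big_distrr /=.
have det_inj (w : T -> 'cV[R]_m) (f : {ffun 'I_m -> T}) : ~~ injectiveb f ->
    \det (\matrix_(i, j) w (f j) i 0) = 0 :> R.
  case/injectivePn => i [j ij fij]; rewrite -det_tr.
  by apply: (determinant_alternate ij) => l; rewrite !mxE fij.
rewrite (bigID (fun f : {ffun 'I_m -> T} => injectiveb f)) /= [X in _ + X]big1 ?addr0; last first.
  by move=> f fNI; rewrite /W det_inj ?mulr0.
pose im (f : {ffun 'I_m -> T}) := f @: 'I_m.
rewrite (partition_big im (fun F => #|F| == m)) /= => [|f /injectiveP fI]; last first.
  by rewrite card_imset // card_ord.
apply: eq_bigr => F /eqP Fm.
have enumF j : (j < m)%N -> (j < size (enum F))%N by rewrite -cardE Fm.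
(* The default [t0] is never returned for an index below [m], the size of [enum F]. *)
pose e j := nth t0 (enum F) j.
rewrite (eq_bigr (fun=> \prod_(t in F) c t * \det (U e) * \det (W e))) /=.
  rewrite sumr_const; rewrite [RHS]mulr_natl; congr (_ *+ _).
  have := @card_inj_ffuns_on 'I_m T (mem F); rewrite Fm card_ord ffactnn => <-.
  apply: eq_card => f; rewrite !inE andbC -topredE /=.
  case fI: (injectiveb f); rewrite ?andbF ?andbT //.
  apply/eqP/ffun_onP => [<- i|fF]; first exact: imset_f.
  apply/eqP; rewrite eqEcard card_imset; last exact/injectiveP.
  rewrite card_ord Fm leqnn andbT; apply/subsetP => t /imsetP[i _ ->]; exact: fF.
move=> f /andP[/injectiveP fI /eqP fF].
have fin i : f i \in enum F by rewrite mem_enum -fF imset_f.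
have s_lt i : (index (f i) (enum F) < m)%N by rewrite -[ltnRHS]Fm cardE index_mem.
pose s0 i := Ordinal (s_lt i).
have s0I : injective s0.
  move=> i j [/(congr1 (nth t0 (enum F)))]; rewrite !nth_index //; exact: fI.
pose s := perm s0I.
have fe i : f i = e (s i) by rewrite permE /e /= nth_index.
have dete (w : T -> 'cV[R]_m) : \det (\matrix_(i, j) w (f j) i 0) =
   (-1) ^+ s * \det (\matrix_(i, j) w (e j) i 0) :> R.
  rewrite -(det_comp_perm _ (fun j : 'I_m => e j)); congr (\det _).
  by apply/matrixP => i j; rewrite !mxE fe.
rewrite /U /W !dete -!mulrA; congr (_ * _).
  by rewrite -fF big_imset /=; [apply: eq_bigl => i; rewrite inE | move=> i j _ _; apply: fI].
by rewrite mulrCA; congr (_ * _); rewrite mulrA -expr2 sqrr_sign mul1r.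
Qed.

End CauchyBinet.

(** [None] stands for an endpoint whose row has been deleted; [h = t] gives a zero column, as for a
    loop. *)
Definition incidence_mx m n (M : 'M[R]_(m, n)) :=
  forall b, exists h t : option 'I_m,
    forall a, M a b = (h == Some a)%:R - (t == Some a)%:R.

(* Poincare's induction: a column with one nonzero entry is expanded, and if
   there is none then the rows add up to 0. *)
Lemma incidence_det m (M : 'M[R]_m) :
  incidence_mx M -> \det M \in [:: 0; 1; -1].
Proof.
elim: m M => [|m IH] M incM; first by rewrite det_mx00 !inE eqxx orbT.
(* Deleting row [i] turns an endpoint [i] into [None], which is the effect of [unlift i]. *)
have minorP i j : incidence_mx (row' i (col' j M)).
  move=> b; have [h [t Mb]] := incM (lift j b).
  exists (obind (unlift i) h), (obind (unlift i) t) => a; rewrite !mxE Mb.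
  have bindE (o : option 'I_m.+1) : (obind (unlift i) o == Some a) = (o == Some (lift i a)).
    case: o => [z|] //=; case: unliftP => [z'|] -> /=.
      by rewrite !(inj_eq Some_inj) (inj_eq lift_inj).
    by rewrite (inj_eq Some_inj) (negPf (neq_lift _ _)).
  by rewrite !bindE.
have single j i (d : R) : d ^+ 2 = 1 -> (forall a, M a j = d * (i == a)%:R) ->
    \det M \in [:: 0; 1; -1].
  move=> d1 Mj; rewrite (expand_det_col M j) (bigD1 i) //= big1 ?addr0.
    rewrite Mj eqxx mulr1 /cofactor; have := IH _ (minorP i j).
    have: d * (-1) ^+ (i + j) \in [:: 1; -1].
      by rewrite !inE -eqf_sqr expr1n exprMn d1 mul1r sqrr_sign.
    rewrite mulrA !inE.
    by case/orP => /eqP-> /or3P[]/eqP->; rewrite ?mulr0 ?mulN1r ?mul1r ?opprK ?eqxx ?orbT.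
  by move=> a /negPf ai; rewrite Mj eq_sym ai mulr0 mul0r.
have [/existsP[j /existsP[i /forallP Mj]]|/existsPn noplus] :=
   boolP [exists j, exists i, forall a, M a j == (i == a)%:R].
  by apply: (single j i 1) => [|a]; rewrite ?expr1n // (eqP (Mj a)) mul1r.
have [/existsP[j /existsP[i /forallP Mj]]|/existsPn nominus] :=
   boolP [exists j, exists i, forall a, M a j == - (i == a)%:R].
  by apply: (single j i (-1)) => [|a]; rewrite ?sqrrN ?expr1n // (eqP (Mj a)) mulN1r.
suff /eqP-> : \det M == 0 by rewrite inE eqxx.
apply/det0P; exists (const_mx 1).
  by apply/eqP => /rowP/(_ 0); rewrite !mxE; apply/eqP; rewrite oner_eq0.
apply/rowP => j; rewrite !mxE; under eq_bigr do rewrite mxE mul1r.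
have [[h|] [[t|] Mj]] := incM j; under eq_bigr do rewrite Mj; rewrite sumrB.
- have sum1 (z : 'I_m.+1) : \sum_a (Some z == Some a)%:R = 1 :> R.
    rewrite (bigD1 z) //= eqxx big1 ?addr0 // => a /negPf az.
    by rewrite (inj_eq Some_inj) eq_sym az.
  by rewrite !sum1 subrr.
- have /existsP[] := noplus j; exists h; apply/forallP => a.
  by rewrite Mj (inj_eq Some_inj) subr0.
- have /existsP[] := nominus j; exists t; apply/forallP => a.
  by rewrite Mj (inj_eq Some_inj) sub0r.
- by rewrite subrr.
Qed.

Lemma incidence_row_mx m n1 n2 (A : 'M[R]_(m, n1)) (B : 'M[R]_(m, n2)) :
  incidence_mx A -> incidence_mx B -> incidence_mx (row_mx A B).
Proof.
move=> incA incB b; rewrite -(splitK b); case: (split b) => b' /=.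
  by have [h [t Ab]] := incA b'; exists h, t => a; rewrite row_mxEl.
by have [h [t Bb]] := incB b'; exists h, t => a; rewrite row_mxEr.
Qed.

Lemma incidence_colsub m n1 n2 (f : 'I_n2 -> 'I_n1) (A : 'M[R]_(m, n1)) :
  incidence_mx A -> incidence_mx (colsub f A).
Proof. by move=> incA b; have [h [t Ab]] := incA (f b); exists h, t => a; rewrite mxE. Qed.

Lemma incidence_unit_det m (M : 'M[R]_m) :
  incidence_mx M -> M \in unitmx -> \det M ^+ 2 = 1.
Proof.
move=> /incidence_det; rewrite unitmxE unitfE !inE => /or3P[]/eqP-> //.
- by rewrite eqxx.
- by rewrite expr1n.
- by rewrite sqrrN expr1n.
Qed.

End Determinants.

(** * Potentials on multigraphs *)

Section Orientation.
Variables (W E : finType) (H : multigraph W E) (T : {set E}) (h t : E -> W).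

(** One notion covers the simple graph, its quotient and the port graph; [h e = t e] is allowed and
    describes a loop. *)
Definition oriented := forall e, e \in T ->
  [/\ h e \in mg_verts H, t e \in mg_verts H
    & {in mg_verts H &, forall u v, mg_joins H e u v =
        (u == h e) && (v == t e) || (u == t e) && (v == h e)}].

Hypothesis orT : oriented.

Lemma connect_const (X : Type) (f : W -> X) (T' : {set E}) u v :
  T' \subset T -> {in T', forall e, f (h e) = f (t e)} ->
  connect (mg_adj H T') u v -> f u = f v.
Proof.
move=> /subsetP sT fT /connectP[p]; elim: p u => [|w p IH] u /=; first by move=> _ ->.
case/andP => /and3P[uH wH /exists_inP[e eT ej]] pth vE; rewrite -(IH w pth vE).
have [_ _ eE] := orT (sT e eT); move: ej; rewrite eE //.
by case/orP => /andP[/eqP-> /eqP->]; rewrite fT.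
Qed.

Lemma connect_edge (T' : {set E}) e u :
  T' \subset T -> e \in T' ->
  connect (mg_adj H T') u (h e) = connect (mg_adj H T') u (t e).
Proof.
move=> /subsetP sT eT; have [he te eE] := orT (sT e eT).
by apply/idP/idP => /connect_trans; apply; apply: connect1; rewrite /mg_adj he te;
   apply/exists_inP; exists e; rewrite // eE // !eqxx ?orbT.
Qed.

Lemma mg_connected_eq_on (X : eqType) (f : W -> X) :
  mg_connected H T -> {in T, forall e, f (h e) = f (t e)} ->
  {in mg_verts H &, forall u v, f u = f v}.
Proof.
move=> /forall_inP cT fT u v uH vH; have /forall_inP := cT _ uH.
by move=> /(_ _ vH); apply: connect_const.
Qed.

(** Boolean functions suffice: the indicator of the set reached from [u] is constant along edges. *)
Lemma eq_on_mg_connected :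
  (forall f : W -> bool, {in T, forall e, f (h e) = f (t e)} ->
     {in mg_verts H &, forall u v, f u = f v}) -> mg_connected H T.
Proof.
move=> constT; apply/forall_inP => u uH; apply/forall_inP => v vH.
rewrite -(constT (fun w => connect (mg_adj H T) u w) _ u v) // => e eT.
exact: connect_edge.
Qed.

Let joins (z z' : W * E) := mg_joins H z.2 z.1 z'.1.

(** Lifts a vertex path without repetition to the list format of [mg_cycle]. An edge leaving [u]
    cannot recur, as both ends of the later edges avoid [u]. The last clause leaves room for an edge
    [y0] before the path and an end [y] after it, so that the path can be closed to a cycle. *)
Lemma edge_path (T' : {set E}) u p :
    T' \subset T -> path (mg_adj H T') u p -> uniq (u :: p) ->
  exists s, [/\ unzip1 s = belast u p,
    all (fun z => (z.1 \in mg_verts H) && (z.2 \in T')) s, uniq (unzip2 s),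
    all (fun z => (h z.2 \in u :: p) && (t z.2 \in u :: p)) s
    & forall y0 y, joins y0 (u, y0.2) -> y.1 = last u p -> path joins y0 (rcons s y)].
Proof.
move=> /subsetP sT; elim: p u => [|v p IH] u /=.
  by move=> _ _; exists [::]; split=> //= -[? ?] [? ?] /= j ->; rewrite /joins /= in j *; rewrite j.
case/andP => /and3P[uH vH /exists_inP[e eT ej]] pth /andP[unp up].
have [s [s1 sT' us sin spath]] := IH v pth up.
have [_ _ eE] := orT (sT e eT).
have uvE: (u == h e) && (v == t e) || (u == t e) && (v == h e) by rewrite -eE.
exists ((u, e) :: s); split => /=.
- by rewrite s1.
- by rewrite uH eT.
- rewrite us andbT; apply/mapP => -[z zs ez].
  have /andP[] := allP sin z zs; rewrite -ez => hin tin.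
  by case/orP: uvE => /andP[/eqP ue _]; move: unp; rewrite ue (hin, tin).
- apply/andP; split.
    by rewrite !inE; case/orP: uvE => /andP[/eqP<- /eqP<-]; rewrite !eqxx ?orbT.
  apply/allP => z zs; have /andP[hz tz] := allP sin z zs.
  by rewrite in_cons hz orbT in_cons tz orbT.
- by move=> y0 y j0 yl; apply/andP; split=> //; apply: spath.
Qed.

(** A path from [h e] to [t e] avoiding [e] would be closed to a cycle by [e]. *)
Lemma mg_acyclic_disconnect e : mg_acyclic H T -> e \in T ->
  ~~ connect (mg_adj H (T :\ e)) (h e) (t e).
Proof.
move=> /mg_acyclicP acT eT; apply/connectP => -[p0 pth0 tl0].
case: (shortenP pth0) tl0 => p pth up _ tl {p0 pth0}.
have [s [s1 sT us _ spath]] := edge_path (subsetDl _ _) pth up.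
have [he te eE] := orT eT.
have /negP := acT ((t e, e) :: s); apply.
apply/and5P; split => //=.
- rewrite te eT; apply: sub_all sT => z /andP[-> /=].
  by rewrite in_setD1 => /andP[].
- move: up; rewrite s1 lastI rcons_uniq => /andP[+ ->].
  by rewrite -tl => ->.
- rewrite us andbT; apply/mapP => -[z zs ez].
  by have /andP[_] := allP sT z zs; rewrite in_setD1 -ez eqxx.
- by apply: spath => //; rewrite /joins /= eE // !eqxx orbT.
Qed.

Section Potentials.
Variable (R : nzRingType).

(** [f] is the indicator of the vertices reached from [h e] without [e]: removing [e] separates its
    ends. *)
Lemma mg_acyclic_dual e : mg_acyclic H T -> e \in T ->
  exists2 f : W -> R, f (h e) - f (t e) = 1
    & {in T :\ e, forall e', f (h e') = f (t e')}.
Proof.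
move=> acT eT.
exists (fun w => (connect (mg_adj H (T :\ e)) (h e) w)%:R) => [|e' eT'].
  by rewrite connect0 (negPf (mg_acyclic_disconnect acT eT)) subr0.
by rewrite (connect_edge _ _ eT') // subsetDl.
Qed.

(** On a cycle through [e], a function constant along the other edges takes equal values at the two
    ends of [e], so it cannot drop by 1 there. *)
Lemma dual_mg_acyclic :
    {in T, forall e, exists2 f : W -> R, f (h e) - f (t e) = 1
       & {in T :\ e, forall e', f (h e') = f (t e')}} ->
  mg_acyclic H T.
Proof.
move=> dualT; apply/mg_acyclicP => -[//|[v e] s].
apply/negP => /and5P[_ /= /andP[/andP[vH eT] sT] us1 /andP[es us] cyc].
have [f fe fT] := dualT e eT; have [he te eE] := orT eT.
have path_f z s' y : all (fun z => (z.1 \in mg_verts H) && (z.2 \in T :\ e)) (z :: s') ->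
    y.1 \in mg_verts H -> path joins z (rcons s' y) -> f z.1 = f y.1.
  elim: s' z => [|z' s' IH] z.
    rewrite /= !andbT => /andP[zH zT] yH zy; have := zT; rewrite in_setD1 => /andP[_ zT'].
    have [_ _ zE] := orT zT'; move: zy; rewrite /joins zE //.
    by case/orP => /andP[/eqP-> /eqP->]; rewrite fT.
  rewrite -/([:: z, z' & s']) => /andP[/andP[zH zT] /[dup] az'] /= /andP[/andP[z'H _] _] yH.
  case/andP => zz' pth; rewrite -(IH z' az' yH pth).
  have := zT; rewrite in_setD1 => /andP[_ zT'].
  have [_ _ zE] := orT zT'; move: zz'; rewrite /joins zE //.
  by case/orP => /andP[/eqP-> /eqP->]; rewrite fT.
have sTe : all (fun z => (z.1 \in mg_verts H) && (z.2 \in T :\ e)) s.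
  apply/allP => z zs; have /andP[-> zT] := allP sT z zs; rewrite in_setD1 zT andbT.
  by apply: contra es => /eqP<-; apply: map_f.
(* [w] is the vertex after [v] on the cycle; for a cycle of length 1 it is [v] itself. *)
have [w wH [vw fw]] : exists2 w, w \in mg_verts H & mg_joins H e v w /\ f w = f v.
  case: s cyc sTe {us1 es us sT} => [|z s] /=.
    by rewrite andbT => ? _; exists v.
  case/andP => vz pth sTe; exists z.1; first by case/andP: sTe => /andP[].
  by split=> //; rewrite (path_f z s (v, e)).
move: vw fw; rewrite eE //.
by case/orP => /andP[/eqP-> /eqP->] fw; move: fe; rewrite fw subrr => /esym/eqP; rewrite oner_eq0.
Qed.

End Potentials.
End Orientation.

(** * Reduced incidence matrices *)

Section ReducedIncidence.
Variables (R : realFieldType) (W : finType) (m : nat) (rho : 'I_m -> W) (w0 : W).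

Definition reduced_incidence l (h t : 'I_l -> W) : 'M[R]_(m, l) :=
  \matrix_(a, b) ((rho a == h b)%:R - (rho a == t b)%:R).

Definition enum_off (S : {set W}) :=
  [/\ injective rho, forall a, rho a != w0 & S = w0 |: [set rho a | a : 'I_m]].

(** Under [enum_off], this is the extension of [u] by 0 to the ground [w0]. Multiplying [u] by a
    reduced incidence matrix yields the drops of this potential along the edges. *)
Definition potential (u : 'rV[R]_m) (w : W) := \sum_a u 0 a * (rho a == w)%:R.

Lemma mul_reduced_incidence l (h t : 'I_l -> W) u b :
  (u *m reduced_incidence h t) 0 b = potential u (h b) - potential u (t b).
Proof. by rewrite mxE -sumrB; apply: eq_bigr => a _; rewrite mxE mulrBr. Qed.

Variable S : {set W}.
Hypothesis rhoS : enum_off S.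

Lemma potential_off u : potential u w0 = 0.
Proof. by have [_ /(_ _)/negPf r0 _] := rhoS; apply: big1 => a _; rewrite r0 mulr0. Qed.

Lemma potentialE u a : potential u (rho a) = u 0 a.
Proof.
have [rI _ _] := rhoS; rewrite /potential (bigD1 a) //= eqxx mulr1 big1 ?addr0 //.
by move=> b /negPf ba; rewrite (inj_eq rI) ba mulr0.
Qed.

Lemma potential_row (f : W -> R) w : w \in S ->
  potential (\row_a (f (rho a) - f w0)) w = f w - f w0.
Proof.
have [_ _ ->] := rhoS; rewrite !inE => /orP[/eqP->|/imsetP[a _ ->]].
  by rewrite potential_off subrr.
by rewrite potentialE mxE.
Qed.

(** Rows that tabulate functions vanishing at [w0] are potentials, so the product consists of their
    drops. The block, port and component matrices are all multiplied out this way. *)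
Lemma mul_matrix_incidence k (F : 'I_k -> W -> R) l (h t : 'I_l -> W) :
    (forall i, F i w0 = 0) -> (forall b, h b \in S) -> (forall b, t b \in S) ->
  (\matrix_(i, a) F i (rho a)) *m reduced_incidence h t =
  \matrix_(i, b) (F i (h b) - F i (t b)).
Proof.
move=> F0 hS tS; apply/matrixP => i b; rewrite [RHS]mxE.
transitivity (((\row_a (F i (rho a) - F i w0)) *m reduced_incidence h t) 0 b).
  by rewrite !mxE; apply: eq_bigr => a _; rewrite !mxE F0 subr0.
by rewrite mul_reduced_incidence !potential_row // F0 !subr0.
Qed.

Lemma potential_eq0 u : {in S, forall w, potential u w = potential u w0} -> u = 0.
Proof.
move=> u0; apply/rowP => a; rewrite mxE -potentialE u0 ?potential_off //.
by have [_ _ ->] := rhoS; rewrite !inE imset_f ?orbT.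
Qed.

Lemma sum_enum_off (f : W -> R) : S = [set: W] -> \sum_w f w = f w0 + \sum_a f (rho a).
Proof.
have [rI r0 ->] := rhoS => ST; rewrite (bigD1 w0) //=; congr (_ + _).
rewrite -(big_imset f (A := predT)) /=; last by move=> a b _ _ /rI.
apply: eq_bigl => w; have /setP/(_ w) := ST; rewrite !inE; case: eqVneq => [->|] //= _.
by apply/esym/imsetP => -[a _ w0E]; move: (r0 a); rewrite -w0E eqxx.
Qed.

Lemma reduced_incidence_mx l (h t : 'I_l -> W) : incidence_mx (reduced_incidence h t).
Proof.
have [rI _ _] := rhoS.
have row_of w : exists o : option 'I_m, forall a, (rho a == w) = (o == Some a).
  case: (pickP (fun a => rho a == w)) => [a /eqP<-|no]; last by exists None.
  by exists (Some a) => b; rewrite (inj_eq rI) eq_sym.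
move=> b; have [o oE] := row_of (h b); have [o' oE'] := row_of (t b).
by exists o, o' => a; rewrite mxE oE oE'.
Qed.

Section Multigraph.
Variables (E : finType) (H : multigraph W E) (T : {set E}) (h t : E -> W).
Variables (l : nat) (f : 'I_l -> E).
Hypotheses (orT : oriented H T h t) (vertsH : mg_verts H = S).
Hypotheses (fI : injective f) (fT : [set f j | j : 'I_l] = T).

Let N := reduced_incidence (h \o f) (t \o f).

Let fin j : f j \in T. Proof. by rewrite -fT imset_f. Qed.

Let inT e : e \in T -> exists j, e = f j.
Proof. by rewrite -fT => /imsetP[j _ ->]; exists j. Qed.

(** A left kernel vector is a potential without drops, hence constant when the multigraph is
    connected, hence 0 as it vanishes at [w0]. *)
Lemma connected_row_free : mg_connected H T = row_free N.
Proof.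
apply/idP/idP => [conT | /row_freeP[N' NN']].
  apply: inj_row_free => u uN; apply: potential_eq0 => w wS.
  apply: (mg_connected_eq_on orT conT); rewrite ?vertsH //.
    move=> _ /inT[j ->]; apply/eqP; rewrite -subr_eq0.
    by rewrite -[h _]/((h \o f) j) -[t _]/((t \o f) j) -mul_reduced_incidence uN mxE.
  by have [_ _ ->] := rhoS; rewrite setU11.
apply: (eq_on_mg_connected orT) => F FT.
(* A boolean function constant along edges, read in [R] and normalised at [w0], lies in the left
   kernel. *)
pose F' w : R := (F w)%:R; pose u : 'rV[R]_m := \row_a (F' (rho a) - F' w0).
have u0 : u = 0.
  rewrite -[u]mulmx1 -NN' mulmxA; suff -> : u *m N = 0 by rewrite mul0mx.
  apply/rowP => j; rewrite mul_reduced_incidence mxE /=.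
  have [hS tS _] := orT (fin j); rewrite vertsH in hS tS.
  by rewrite !potential_row // /F' FT // subrr.
have FE w : w \in mg_verts H -> F w = F w0.
  rewrite vertsH => /(potential_row F'); rewrite -/u u0 /potential big1 => [|a _].
    by move=> /esym/eqP; rewrite subr_eq0 /F'; case: (F w) (F w0) => [] [] //;
       rewrite ?(eq_sym 0) oner_eq0.
  by rewrite mxE mul0r.
by move=> v w vH wH; rewrite !FE.
Qed.

(** The rows of a left inverse of [N] are the dual potentials of the edges: drop 1 along one edge,
    drop 0 along the others. *)
Lemma acyclic_row_full : mg_acyclic H T = row_full N.
Proof.
apply/idP/row_fullP => [acT | [B BN]].
  have /fin_all_exists2[F F1 F0] (j : 'I_l) := mg_acyclic_dual orT R acT (fin j).
  exists (\matrix_(j, a) (F j (rho a) - F j w0)).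
  apply/matrixP => j j'; rewrite [RHS]mxE.
  rewrite -(_ : (\row_a (F j (rho a) - F j w0) *m N) 0 j' = (j == j')%:R).
    by rewrite !mxE; apply: eq_bigr => a _; rewrite !mxE.
  rewrite mul_reduced_incidence /=.
  have [hS tS _] := orT (fin j'); rewrite vertsH in hS tS; rewrite !potential_row //.
  rewrite opprB addrA subrK; have [<-|jj'] := eqVneq; first exact: F1.
  by rewrite F0 ?subrr // in_setD1 fin (inj_eq fI) eq_sym jj'.
apply: (dual_mg_acyclic orT (R := R)) => _ /inT[j ->].
have BNj j' : potential (row j B) (h (f j')) - potential (row j B) (t (f j')) = (j == j')%:R.
  rewrite -[h _]/((h \o f) j') -[t _]/((t \o f) j') -mul_reduced_incidence -row_mul BN.
  by rewrite !mxE.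
exists (potential (row j B)) => [|e]; first by rewrite BNj eqxx.
rewrite in_setD1 => /andP[+ /inT[j' e_]]; rewrite e_ (inj_eq fI) eq_sym => jj'.
by apply/eqP; rewrite -subr_eq0 BNj (negPf jj').
Qed.

Lemma spanning_tree_card : mg_spanning_tree H T -> l = m.
Proof.
rewrite /mg_spanning_tree connected_row_free acyclic_row_full.
by rewrite /row_free /row_full => /andP[/eqP-> /eqP].
Qed.

End Multigraph.
End ReducedIncidence.

Lemma spanning_tree_det (R : realFieldType) (W E : finType) (m : nat) (rho : 'I_m -> W)
    (w0 : W) (H : multigraph W E) (T : {set E}) (h t : E -> W) (f : 'I_m -> E) :
    enum_off rho w0 (mg_verts H) -> oriented H T h t ->
    injective f -> [set f j | j : 'I_m] = T ->
  mg_spanning_tree H T = (\det (reduced_incidence R rho (h \o f) (t \o f)) != 0).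
Proof.
move=> rhoH orT fI fT; rewrite /mg_spanning_tree.
rewrite (connected_row_free R rhoH orT erefl fT) (acyclic_row_full R rhoH orT erefl fI fT).
by rewrite row_free_unit -unitfE -unitmxE row_full_unit andbb.
Qed.

(** * Block determinants and completed determinants *)

Section Blocks.
Variable R : realFieldType.

(** The middle block row is [0, 1%:M, 0]; [swap] moves the middle rows and columns to the front,
    which leaves a block lower triangular matrix. *)
Lemma det_block3 m r k : exists2 eps : R, eps ^+ 2 = 1 &
  forall (A : 'M[R]_m) (B : 'M[R]_(m, r)) (C : 'M[R]_(m, k))
         (A' : 'M[R]_(k, m)) (B' : 'M[R]_(k, r)) (C' : 'M[R]_k),
  \det (block_mx A (row_mx B C) (col_mx 0 A') (block_mx 1%:M 0 B' C')) =
  eps * \det (block_mx A C A' C').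
Proof.
pose swap (i : 'I_(r + (m + k))) : 'I_(m + (r + k)) :=
  match split i with
  | inl a => rshift m (lshift k a)
  | inr b => match split b with
             | inl b => lshift (r + k) b
             | inr a => rshift m (rshift r a)
             end
  end.
have swap1 a : swap (lshift (m + k) a) = rshift m (lshift k a).
  by rewrite /swap (unsplitK (inl a)).
have swap2 a : swap (rshift r (lshift k a)) = lshift (r + k) a.
  by rewrite /swap (unsplitK (inr (lshift k a))) (unsplitK (inl a)).
have swap3 a : swap (rshift r (rshift m a)) = rshift m (rshift r a).
  by rewrite /swap (unsplitK (inr (rshift m a))) (unsplitK (inr a)).
have swapI : injective swap.
  pose back (j : 'I_(m + (r + k))) : 'I_(r + (m + k)) :=
    match split j with
    | inl a => rshift r (lshift k a)
    | inr b => match split b with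
               | inl b => lshift (m + k) b
               | inr a => rshift r (rshift m a)
               end
    end.
  apply: (@can_inj _ _ swap back) => i.
  rewrite -(splitK i); case: (split i) => [a|b] /=.
    by rewrite swap1 /back (unsplitK (inr (lshift k a))) (unsplitK (inl a)).
  rewrite -(splitK b); case: (split b) => a /=.
    by rewrite swap2 /back (unsplitK (inl a)).
  by rewrite swap3 /back (unsplitK (inr (rshift r a))) (unsplitK (inr a)).
have [eps eps1 epsE] := det_mxsub_inj R swapI swapI (addnCA r m k).
exists eps => // A B C A' B' C'.
set M := (X in \det X = _).
have -> : \det M = eps * \det (mxsub swap swap M).
  by rewrite epsE mulrA -expr2 eps1 mul1r.
congr (_ * _).
have -> : mxsub swap swap M = block_mx 1%:M 0 (col_mx B B') (block_mx A C A' C').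
  rewrite /M; apply/matrixP => i j; rewrite mxE.
  rewrite -(splitK i) -(splitK j); case: (split i) => {}i; case: (split j) => {}j /=;
    rewrite ?swap1.
  - by rewrite block_mxEdr !block_mxEul.
  - rewrite block_mxEur [RHS]mxE -(splitK j); case: (split j) => {}j /=;
    rewrite ?swap2 ?swap3.
    + by rewrite block_mxEdl col_mxEu mxE.
    + by rewrite block_mxEdr block_mxEur mxE.
  - rewrite block_mxEdl -(splitK i); case: (split i) => {}i /=;
    rewrite ?swap2 ?swap3.
    + by rewrite block_mxEur row_mxEl col_mxEu.
    + by rewrite block_mxEdr block_mxEdl col_mxEd.
  - rewrite block_mxEdr -(splitK i) -(splitK j); case: (split i) => {}i; case: (split j) => {}j /=;
    rewrite ?swap2 ?swap3.
    + by rewrite !block_mxEul.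
    + by rewrite !block_mxEur row_mxEr.
    + by rewrite !block_mxEdl col_mxEd.
    + by rewrite !block_mxEdr.
by rewrite det_lblock det1 mul1r.
Qed.

(* Both sides are, up to signs independent of [E], the determinant of the rows
   [Pi], [Q], [E^T Th]: multiply it by [[s0 | D]] and by [[N | s]], the columns of [s]
   being inserted inside [N]. *)
Lemma det_mul_completed m r k q (e : (r + k)%N = q)
    (Pi : 'M[R]_(m, m + q)) (Th : 'M[R]_(q, m + q))
    (s0 : 'M[R]_(m + q, m)) (D : 'M[R]_(m + q, q))
    (Q : 'M[R]_(r, m + q)) (s : 'M[R]_(m + q, r)) (N : 'M[R]_(m + q, m + k)) :
    col_mx Pi Th *m row_mx s0 D = 1%:M -> Q *m N = 0 -> Q *m s = 1%:M ->
    incidence_mx (row_mx s0 D) -> incidence_mx N -> incidence_mx s ->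
    row_free (row_mx N s) ->
  forall E F : 'M[R]_(q, k),
  \det (col_mx Pi (E^T *m Th) *m N) * \det (col_mx Pi (F^T *m Th) *m N) =
  \det (castmx (e, erefl q) (col_mx (Q *m D) E^T)) *
  \det (castmx (e, erefl q) (col_mx (Q *m D) F^T)).
Proof.
case: q / e Pi Th s0 D Q s N => Pi Th s0 D Q s N PT QN Qs incSD incN incs freeN E F.
rewrite !castmx_id.
(* With [s] placed after the first [m] columns of [N], the product [X G *m Y] below has the shape of
   [det_block3]. *)
pose Y := row_mx (lsubmx N) (row_mx s (rsubmx N)).
have SD1 : \det (row_mx s0 D) ^+ 2 = 1.
  by apply: incidence_unit_det => //; case/mulmx1_unit: PT.
have Y1 : \det Y ^+ 2 = 1.
  apply: incidence_unit_det.
    rewrite /Y lsubmxEsub rsubmxEsub.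
    apply: incidence_row_mx; first exact: incidence_colsub.
    by apply: incidence_row_mx => //; apply: incidence_colsub.
  rewrite -row_free_unit; apply: inj_row_free => u.
  rewrite /Y 2!mul_mx_row -[0 in RHS]hsubmxK => /eq_row_mx[uN1].
  rewrite -[rsubmx 0]hsubmxK => /eq_row_mx[us uN2].
  apply: (row_free_inj freeN); rewrite mul0mx mul_mx_row us -[N]hsubmxK mul_mx_row uN1 uN2.
  by rewrite !linear0 !row_mx0.
move: PT; rewrite mul_col_row scalar_mx_block => /eq_block_mx[Ps PD Ts TD].
pose X (G : 'M[R]_(r + k, k)) := col_mx Pi (col_mx Q (G^T *m Th)).
(* As [Pi *m s0 = 1%:M], [Pi *m D = 0] and [Th *m D = 1%:M], the product is block lower triangular
   with the completed matrix as its last diagonal block. *)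
have XSD G : \det (X G) * \det (row_mx s0 D) = \det (col_mx (Q *m D) G^T).
  rewrite -det_mulmx /X mul_col_row Ps PD !mul_col_mx -!mulmxA TD mulmx1.
  by rewrite det_lblock det1 mul1r.
have [eps eps1 epsE] := det_block3 m r k.
have XY G : \det (X G) * \det Y = eps * \det (col_mx Pi (G^T *m Th) *m N).
  rewrite -det_mulmx /X /Y mul_col_row [Pi *m row_mx _ _]mul_mx_row mul_col_row !mul_col_mx Qs.
  have /eq_row_mx[-> ->] : row_mx (Q *m lsubmx N) (Q *m rsubmx N) = row_mx 0 0.
    by rewrite -mul_mx_row hsubmxK QN row_mx0.
  by rewrite epsE -mul_col_row hsubmxK mul_col_mx.
rewrite -!XSD [RHS]mulrACA -expr2 SD1 mulr1.
transitivity ((eps * \det (col_mx Pi (E^T *m Th) *m N)) *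
   (eps * \det (col_mx Pi (F^T *m Th) *m N))).
  by rewrite mulrACA -expr2 eps1 mul1r.
by rewrite -!XY mulrACA -expr2 Y1 mulr1.
Qed.

Lemma det_schur m k (A : 'M[R]_m) B C (D : 'M[R]_k) : A \in unitmx ->
  \det (block_mx A B C D) = \det A * \det (D - C *m invmx A *m B).
Proof.
move=> uA; transitivity (\det (block_mx A B C D *m block_mx 1%:M (- (invmx A *m B)) 0 1%:M)).
  by rewrite det_mulmx det_ublock !det1 !mulr1.
rewrite mulmx_block !mulmx1 !mulmx0 !addr0 !mulmxN !mulmxA mulmxV // mul1mx addNr.
by rewrite det_lblock [_ + D]addrC.
Qed.

(* In [col_mx B (selE hI)^T], the columns [I] carry an identity block and the
   others zeros in the last [k] rows. *)
Lemma det_completed q r k (e : (r + k)%N = q) (I : {set 'I_q}) (hI : #|I| = k)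
    (hJ : #|~: I| = r) :
  exists2 eps : R, eps ^+ 2 = 1 & forall B : 'M[R]_(r, q),
  \det (castmx (e, erefl q) (col_mx B (selE R hI)^T)) = eps * \det (colsub (elt hJ) B).
Proof.
pose g (j : 'I_(r + k)) := match split j with inl a => elt hJ a | inr b => elt hI b end.
have eltI (I' : {set 'I_q}) l (h : #|I'| = l) : injective (elt h).
  by move=> a b /enum_val_inj/cast_ord_inj.
have eltP (I' : {set 'I_q}) l (h : #|I'| = l) a : elt h a \in I' by apply: enum_valP.
have IJ a b : (elt hI a == elt hJ b) = false.
  by apply/negbTE; apply: contraTneq (eltP _ _ hJ b) => <-; rewrite inE negbK.
have gI : injective g.
  move=> i j; rewrite /g -(splitK i) -(splitK j).
  case: (split i) => {}i; case: (split j) => {}j /=.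
  - by rewrite (unsplitK (inl i)) (unsplitK (inl j)) => /eltI->.
  - by rewrite (unsplitK (inl i)) (unsplitK (inr j)) => /esym/eqP; rewrite IJ.
  - by rewrite (unsplitK (inr i)) (unsplitK (inl j)) => /eqP; rewrite IJ.
  - by rewrite (unsplitK (inr i)) (unsplitK (inr j)) => /eltI->.
have [eps eps1 epsE] := det_mxsub_inj R (@cast_ord_inj _ _ e) gI e.
exists eps => // B; set M := castmx _ _.
have -> : \det M = eps * \det (mxsub (cast_ord e) g M).
  by rewrite epsE mulrA -expr2 eps1 mul1r.
congr (_ * _).
have -> : mxsub (cast_ord e) g M = block_mx (colsub (elt hJ) B) (colsub (elt hI) B) 0 1%:M.
  apply/matrixP => i j; rewrite mxE castmxE cast_ordK cast_ord_id /g.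
  rewrite -(splitK i) -(splitK j); case: (split i) => {}i; case: (split j) => {}j /=;
    rewrite ?(unsplitK (inl j)) ?(unsplitK (inr j)).
  - by rewrite block_mxEul col_mxEu mxE.
  - by rewrite block_mxEur col_mxEu mxE.
  - by rewrite block_mxEdl col_mxEd !mxE eq_sym IJ.
  - by rewrite block_mxEdr col_mxEd !mxE (inj_eq (@eltI _ _ hI)) eq_sym.
by rewrite det_ublock det1 mulr1.
Qed.

End Blocks.

(** * Oriented edges and components of a simple graph *)

Lemma eq_set2 (T : finType) (a b u v : T) :
  ([set a; b] == [set u; v]) = (u == a) && (v == b) || (u == b) && (v == a).
Proof.
apply/eqP/idP => [ab|]; last first.
  by case/orP => /andP[/eqP-> /eqP->] //; rewrite setUC.
have : u \in [set a; b] by rewrite ab set21.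
have : v \in [set a; b] by rewrite ab set22.
have : a \in [set u; v] by rewrite -ab set21.
have : b \in [set u; v] by rewrite -ab set22.
rewrite !inE => /orP[]/eqP-> /orP[]/eqP->; rewrite ?eqxx ?orbT ?orbF ?andbT //=.
Qed.

Section Graph.
Variables (R : realFieldType) (V : finType) (G : {set {set V}}) (c : {set V} -> R) (g : V).
Hypothesis simpleG : simple_graph G.

(** An arbitrary orientation; on two-element sets the default [g] is not reached. *)
Definition edge_head (e : {set V}) : V := odflt g [pick v in e].
Definition edge_tail (e : {set V}) : V := odflt g [pick v in e :\ edge_head e].

Local Notation h := edge_head.
Local Notation t := edge_tail.

Lemma edge_ends e : e \in G -> e = [set h e; t e] /\ h e != t e.
Proof.
move=> /simpleG/eqP/cards2P[u [v [uv ->]]]; rewrite /edge_tail.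
have he : h [set u; v] \in [set u; v].
  rewrite /h; case: pickP => [w //|/(_ u)]; by rewrite set21.
set w := h _ in he *; case: pickP => [z|no] /=.
  move: he; rewrite !inE => /orP[]/eqP-> /andP[/negPf->] /=; rewrite ?orbF.
    by move=> /eqP->.
  by move=> /eqP->; rewrite setUC eq_sym.
move: he; rewrite !inE => /orP[]/eqP wE.
  by have := no v; rewrite !inE wE eqxx orbT eq_sym uv.
by have := no u; rewrite !inE wE eqxx uv.
Qed.

Lemma graph_oriented (F : {set {set V}}) : F \subset G -> oriented (graph_mg V) F h t.
Proof.
move=> /subsetP FG e /FG/edge_ends[eE _]; split; rewrite ?inE // => u v _ _.
by rewrite /= {1}eE eq_set2.
Qed.

Definition edge_sign (v : V) (e : {set V}) : R := (v == h e)%:R - (v == t e)%:R.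

(** The factorisation into one rank-one term per edge, as Cauchy-Binet requires. Off the diagonal
    only the edge [[set u; v]] contributes. *)
Lemma laplacianE u v :
  laplacian G c u v = \sum_(e in G) c e * edge_sign u e * edge_sign v e.
Proof.
rewrite /laplacian; have [<-|uv] := eqVneq u v.
  rewrite [RHS](bigID (fun e : {set V} => u \in e)) /= [X in _ + X]big1 ?addr0.
    apply: eq_bigr => e /andP[eG]; have [eE ht] := edge_ends eG; rewrite {1}eE !inE /edge_sign.
    case: (eqVneq u (h e)) => [->|_] /=; first by rewrite (negPf ht) subr0 !mulr1.
    by move=> ->; rewrite sub0r mulrN1 mulrN1 opprK.
  move=> e /andP[eG]; have [eE _] := edge_ends eG; rewrite {1}eE !inE negb_or /edge_sign.
  by case/andP => /negPf-> /negPf->; rewrite subrr mulr0.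
have term e : e \in G ->
    edge_sign u e * edge_sign v e = - (e == [set u; v])%:R.
  move=> eG; have [eE ht] := edge_ends eG; rewrite {3}eE eq_set2 /edge_sign.
  case: (eqVneq u (h e)) uv => [-> hv|_ uv] /=.
    by rewrite (negPf ht) subr0 mul1r [v == h e]eq_sym (negPf hv) sub0r orbF.
  case: (eqVneq u (t e)) uv => [-> tv|_ _] /=; last by rewrite subrr mul0r oppr0.
  by rewrite sub0r [v == t e]eq_sym (negPf tv) subr0 mulN1r.
rewrite (eq_bigr (fun e => - (c e * (e == [set u; v])%:R))); last first.
  by move=> e eG; rewrite -mulrA term // mulrN.
rewrite sumrN; case: ifP => [uvG|uvG].
  rewrite (bigD1 [set u; v]) //= eqxx mulr1 big1 ?addr0 // => e /andP[_ /negPf->].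
  by rewrite mulr0.
rewrite big1 ?oppr0 // => e eG; case: eqP => [ee|_]; last by rewrite mulr0.
by rewrite ee uvG in eG.
Qed.

Lemma currentE U v :
  current G c U v = \sum_(e in G) c e * edge_sign v e * (U (h e) - U (t e)).
Proof.
rewrite /current; under eq_bigr do rewrite laplacianE big_distrl /=.
rewrite exchange_big /=; apply: eq_bigr => e _.
under eq_bigr do rewrite -mulrA; rewrite -big_distrr /=; congr (_ * _).
have delta w : \sum_u (u == w)%:R * U u = U w.
  rewrite (bigD1 w) //= eqxx mul1r big1 ?addr0 // => u /negPf->.
  by rewrite mul0r.
by rewrite -!delta -sumrB; apply: eq_bigr => u _; rewrite mulrBl.
Qed.

(** The two signs of each edge cancel. This supplies the current balance on the block of [g], which
    has no coordinate of its own. *)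
Lemma sum_current U : \sum_v current G c U v = 0.
Proof.
under eq_bigr do rewrite currentE; rewrite exchange_big /= big1 // => e _.
rewrite -big_distrl -big_distrr /=.
have delta w : \sum_u (u == w)%:R = 1 :> R.
  by rewrite (bigD1 w) //= eqxx big1 ?addr0 // => u /negPf->.
by rewrite /edge_sign sumrB !delta subrr mulr0 mul0r.
Qed.

(** * Components of a spanning subgraph *)

Section Components.
Variable F : {set {set V}}.
Hypothesis FG : F \subset G.
Local Notation conn := (connect (mg_adj (graph_mg V) F)).
Local Notation comp := (pblock (components F)).

Lemma adj_sym : symmetric (mg_adj (graph_mg V) F).
Proof.
move=> u v; rewrite /mg_adj andbCA; congr [&& _, _ & _].
by apply: eq_existsb => e; rewrite /= setUC.
Qed.

Let conn_equiv : {in [set: V] & &, equivalence_rel conn}.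
Proof.
move=> u v w _ _ _; split; first exact: connect0.
by move=> uv; apply: (same_connect (sym_connect_sym adj_sym)) uv _.
Qed.

Lemma mem_comp u : u \in comp u.
Proof.
rewrite mem_pblock /components (cover_partition (equivalence_partitionP conn_equiv)).
by rewrite inE.
Qed.

Lemma mem_compE u v : (v \in comp u) = conn u v.
Proof. by rewrite pblock_equivalence_partition ?inE. Qed.

Let trivC : trivIset (components F).
Proof. by have /and3P[] := equivalence_partitionP conn_equiv. Qed.

Lemma eq_compE u v : (comp u == comp v) = conn u v.
Proof. by rewrite eq_pblock ?mem_compE // -mem_pblock mem_comp. Qed.

Lemma comp_in u : comp u \in components F.
Proof. by rewrite pblock_mem // -mem_pblock mem_comp. Qed.

Lemma mem_componentE B u : B \in components F -> (u \in B) = (B == comp u).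
Proof.
move=> BC; apply/idP/eqP => [uB|->]; last exact: mem_comp.
by rewrite (def_pblock trivC BC uB).
Qed.

Lemma componentP B : B \in components F -> exists u, B = comp u.
Proof.
move=> BC; have /and3P[_ _ B0] := equivalence_partitionP conn_equiv.
have [B_0|[u uB]] := set_0Vmem B; first by rewrite -B_0 [_ \in _]BC in B0.
by exists u; apply/eqP; rewrite -mem_componentE.
Qed.

Lemma comp_edge e : e \in F -> comp (h e) = comp (t e).
Proof.
move=> eF; apply/eqP; rewrite eq_compE.
by rewrite -(connect_edge (graph_oriented FG) _ (subxx _) eF) connect0.
Qed.

Lemma component_order_exists : exists r (C : 'I_r.+1 -> {set V}), component_order g F C.
Proof.
pose s := comp g :: enum (components F :\ comp g).
have us : uniq s by rewrite /s /= mem_enum setD11 enum_uniq.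
have ms : s =i components F.
  move=> B; rewrite inE mem_enum in_setD1; case: eqP => [->|] //=.
  by rewrite comp_in.
exists (size s).-1, (fun i => nth set0 s i); split.
- by move=> i j /eqP; rewrite nth_uniq // => /eqP/val_inj.
- apply/setP => B; rewrite -ms; apply/imsetP/idP => [[i _ ->]|Bs]; first exact: mem_nth.
  have Bi : (index B s < (size s).-1.+1)%N by move: Bs; rewrite -index_mem.
  by exists (Ordinal Bi); rewrite //= nth_index.
- exact: mem_comp.
Qed.

Lemma component_order_card r (C : 'I_r.+1 -> {set V}) :
  component_order g F C -> #|components F| = r.+1.
Proof. by case=> CI <- _; rewrite card_imset // card_ord. Qed.

(** Makes the component of [g] the deleted vertex of the reduced incidence matrix of the quotient
    port graph. *)
Lemma component_order_off r (C : 'I_r.+1 -> {set V}) :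
  component_order g F C -> enum_off (C \o lift ord0) (C ord0) (components F).
Proof.
case=> CI CF _; split=> [a b /CI/lift_inj //|a|].
  by rewrite (inj_eq CI) eq_sym neq_lift.
rewrite -CF; apply/setP => B; rewrite !inE; apply/imsetP/orP => [[i _ ->]|[/eqP->|]].
- case: (unliftP ord0 i) => [j|] ->; last by left.
  by right; apply: imset_f.
- by exists ord0.
- by case/imsetP => i _ ->; exists (lift ord0 i).
Qed.

End Components.
End Graph.

(** * Networks with contracted blocks *)

Section Network.
Variables (R : realFieldType) (V : finType) (G : {set {set V}}) (c : {set V} -> R).
Variables (q : nat) (root : V -> V) (x : 'I_q -> V) (g : V).
Hypotheses (simpleG : simple_graph G) (connG : mg_connected (graph_mg V) G).
Hypothesis cpos : forall e, e \in G -> 0 < c e.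
Hypotheses (rootK : forall v, root (root v) = root v) (root_g : root g = g).
Hypotheses (xI : injective x) (xP : forall v, (v \in [set x i | i : 'I_q]) = (root v != v)).

Local Notation h := (edge_head g).
Local Notation t := (edge_tail g).

(** One representative for each fibre of [root] other than that of [g]; the fibres are the
    contracted blocks. *)
Definition free_roots : {set V} := [set v | (root v == v) && (v != g)].
Local Notation m := #|free_roots|.

(** Lists the vertices other than [g], block roots before ports, so that matrices split into blocks
    along [m + q]. *)
Definition vert (a : 'I_(m + q)) : V :=
  match split a with inl b => enum_val b | inr i => x i end.

Definition block_of v : {set V} := [set w | root w == root v].

Let free_rootP (b : 'I_m) : root (enum_val b) = enum_val b /\ (enum_val b == g) = false.
Proof. by have := enum_valP b; rewrite inE => /andP[/eqP-> /negPf]. Qed.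

Let root_x i : (root (x i) == x i) = false.
Proof. by apply/negbTE; rewrite -xP imset_f. Qed.

Let root_neq_x v i : (root v == x i) = false.
Proof. by apply/eqP => rv; have := root_x i; rewrite -rv rootK eqxx. Qed.

Let x_neq_g i : (x i == g) = false.
Proof. by rewrite -{1}root_g eq_sym root_neq_x. Qed.

Lemma vert_l b : vert (lshift q b) = enum_val b.
Proof. by rewrite /vert (unsplitK (inl b)). Qed.

Lemma vert_r i : vert (rshift m i) = x i.
Proof. by rewrite /vert (unsplitK (inr i)). Qed.

Lemma vert_off : enum_off vert g [set: V].
Proof.
split.
- move=> a b; rewrite -(splitK a) -(splitK b); case: (split a) => {}a;
    case: (split b) => {}b /=; rewrite ?vert_l ?vert_r.
  + by move=> /enum_val_inj->.
  + by have [<- _] := free_rootP a => /eqP; rewrite root_neq_x.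
  + by have [<- _] := free_rootP b => /esym/eqP; rewrite root_neq_x.
  + by move=> /xI->.
- move=> a; rewrite -(splitK a); case: (split a) => {}a /=; rewrite ?vert_l ?vert_r.
    by have [_ ->] := free_rootP a.
  by rewrite x_neq_g.
- apply/setP => v; rewrite !inE; have [//|vg] := eqVneq v g; apply/esym/imsetP => /=.
  have [rv|] := eqVneq (root v) v.
    have vf : v \in free_roots by rewrite inE rv eqxx.
    by exists (lshift q (enum_rank_in vf v)); rewrite // vert_l enum_rankK_in.
  by rewrite -xP => /imsetP[i _ ->]; exists (rshift m i); rewrite ?vert_r.
Qed.

Lemma block_off : enum_off (fun b : 'I_m => block_of (enum_val b)) (block_of g)
  [set block_of v | v : V].
Proof.
have blockE u v : (block_of u == block_of v) = (root u == root v).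
  apply/eqP/eqP => [/setP/(_ u)|uv]; first by rewrite !inE eqxx => /esym/eqP.
  by apply/setP => w; rewrite !inE uv.
split.
- move=> b b' /eqP; rewrite blockE; have [-> _] := free_rootP b.
  by have [-> _] := free_rootP b' => /eqP/enum_val_inj.
- by move=> b; rewrite blockE root_g; have [-> ->] := free_rootP b.
- apply/setP => B; apply/imsetP/setU1P => [[v _ ->]|[->|/imsetP[b _ ->]]]; last first.
  + by exists (enum_val b).
  + by exists g.
  have [rg|rg] := eqVneq (root v) g.
    by left; apply/eqP; rewrite blockE rg root_g.
  have vf : root v \in free_roots by rewrite inE rootK eqxx.
  right; apply/imsetP; exists (enum_rank_in vf (root v)) => //.
  by apply/eqP; rewrite blockE enum_rankK_in // rootK.
Qed.

Lemma block_oriented (F : {set {set V}}) : F \subset G ->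
  oriented (quotient_mg [set block_of v | v : V]) F (block_of \o h) (block_of \o t).
Proof.
move=> /subsetP FG e /FG eG; have [eE _] := edge_ends g simpleG eG.
split; [exact: imset_f|exact: imset_f|] => _ _ /imsetP[u _ ->] /imsetP[v _ ->] /=.
have blockE w w' : w \in block_of w' -> block_of w = block_of w'.
  by rewrite inE => /eqP ww'; apply/setP => z; rewrite !inE ww'.
have mem_block w : w \in block_of w by rewrite inE.
apply/exists_inP/idP => [[w wu /exists_inP[w' w'v]]|].
  rewrite {1}eE eq_set2 -(blockE _ _ wu) -(blockE _ _ w'v).
  by case/orP => /andP[/eqP-> /eqP->]; rewrite !eqxx ?orbT.
case/orP => /andP[/eqP-> /eqP->].
  by exists (h e) => //; apply/exists_inP; exists (t e) => //; rewrite {1}eE.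
by exists (t e) => //; apply/exists_inP; exists (h e) => //; rewrite {1}eE setUC.
Qed.

(** On currents, [Pi] sums over blocks and [Th] reads the ports. On voltages, [Pi^T] spreads a block
    voltage over its block and [Th^T] adds the port voltages at the ports. *)
Definition blocks_mx : 'M[R]_(m, m + q) := \matrix_(b, a) (root (vert a) == enum_val b)%:R.
Definition ports_mx : 'M[R]_(q, m + q) := \matrix_(i, a) (vert a == x i)%:R.
Definition roots_mx : 'M[R]_(m + q, m) :=
  reduced_incidence R vert (fun b => enum_val b) (fun=> g).
Definition port_incidence : 'M[R]_(m + q, q) := reduced_incidence R vert x (root \o x).
Definition edge_incidence l (f : 'I_l -> {set V}) : 'M[R]_(m + q, l) :=
  reduced_incidence R vert (h \o f) (t \o f).
Definition laplacian_mx : 'M[R]_(m + q) :=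
  \matrix_(a, b) laplacian G c (vert a) (vert b).

Local Notation Pi := blocks_mx.
Local Notation Th := ports_mx.
Local Notation Lap := laplacian_mx.

Lemma blocks_mul l (u v : 'I_l -> V) : Pi *m reduced_incidence R vert u v =
  \matrix_(b, j) ((root (u j) == enum_val b)%:R - (root (v j) == enum_val b)%:R).
Proof.
apply: (mul_matrix_incidence vert_off (F := fun b w => (root w == enum_val b)%:R));
  rewrite ?inE // => b; by rewrite root_g eq_sym; have [_ ->] := free_rootP b.
Qed.

Lemma ports_mul l (u v : 'I_l -> V) : Th *m reduced_incidence R vert u v =
  \matrix_(i, j) ((u j == x i)%:R - (v j == x i)%:R).
Proof.
apply: (mul_matrix_incidence vert_off (F := fun i w => (w == x i)%:R));
  rewrite ?inE // => i; by rewrite eq_sym x_neq_g.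
Qed.

(** The inverse change of coordinates: the transposes of [roots_mx] and [port_incidence] read the
    block voltages and the port voltages off a voltage vector. *)
Lemma section_mx : col_mx Pi Th *m row_mx roots_mx port_incidence = 1%:M.
Proof.
rewrite mul_col_row !blocks_mul !ports_mul scalar_mx_block; congr block_mx;
  apply/matrixP => a b; rewrite !mxE /=.
- have [_ ag] := free_rootP a; have [-> _] := free_rootP b.
  by rewrite root_g [g == _]eq_sym ag subr0 (inj_eq enum_val_inj) eq_sym.
- by rewrite rootK subrr.
- have [<- _] := free_rootP b; rewrite root_neq_x [g == _]eq_sym x_neq_g; exact: subrr.
- by rewrite root_neq_x subr0 (inj_eq xI) eq_sym.
Qed.

Lemma section_mxE : [/\ Pi *m roots_mx = 1%:M, Pi *m port_incidence = 0,
  Th *m roots_mx = 0 & Th *m port_incidence = 1%:M].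
Proof. by move: section_mx; rewrite mul_col_row scalar_mx_block => /eq_block_mx[]. Qed.

Definition edge_col e : 'cV[R]_(m + q) := \col_a edge_sign R g (vert a) e.

Lemma laplacian_mxE : Lap = \sum_(e in G) c e *: (edge_col e *m (edge_col e)^T).
Proof.
apply/matrixP => a b; rewrite !mxE (laplacianE c g simpleG) summxE; apply: eq_bigr => e _.
by rewrite !mxE big_ord1 !mxE mulrA.
Qed.

Lemma row_edge_col k (A : 'M[R]_(k, m + q)) i e :
  (A *m edge_col e) i 0 = potential vert (row i A) (h e) - potential vert (row i A) (t e).
Proof.
rewrite -(mul_reduced_incidence _ (fun=> h e) (fun=> t e) _ (0 : 'I_1)) !mxE.
by apply: eq_bigr => a _; rewrite !mxE.
Qed.

Definition quotient_laplacian : 'M[R]_m := Pi *m Lap *m Pi^T.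

(** An energy argument: for [w] in the kernel, the sum of [c e] times the squared drops of [w *m Pi]
    is 0. All drops vanish as conductances are positive, so the potential is 0 by connectedness, and
    [Pi] has a right inverse. *)
Lemma quotient_laplacian_unit : quotient_laplacian \in unitmx.
Proof.
rewrite -row_free_unit; apply: inj_row_free => w w0.
pose y := w *m Pi.
have : y *m Lap *m y^T = 0 by rewrite trmx_mul !mulmxA -(mulmxA w) -(mulmxA w) w0 mul0mx.
have term (e : {set V}) : (y *m edge_col e *m (edge_col e)^T *m y^T) 0 0 =
    ((y *m edge_col e) 0 0) ^+ 2.
  rewrite -mulmxA -trmx_mul mxE big_ord1 [X in _ * X]mxE.
  by rewrite expr2.
rewrite laplacian_mxE mulmx_sumr mulmx_suml => /matrixP/(_ 0 0).
rewrite summxE [RHS]mxE => /eqP; rewrite psumr_eq0; last first.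
  move=> e eG; rewrite -scalemxAr -scalemxAl !mulmxA mxE term.
  by rewrite mulr_ge0 ?sqr_ge0 // ltW ?cpos.
move=> /allP y0; have : y = 0.
  apply: (potential_eq0 vert_off) => v _.
  apply: (mg_connected_eq_on (graph_oriented g simpleG (subxx G)) connG); rewrite ?inE //.
  move=> e eG; have := y0 e (mem_index_enum e); rewrite eG /=.
  rewrite -scalemxAr -scalemxAl !mulmxA mxE term mulf_eq0 sqrf_eq0 gt_eqF ?cpos //=.
  rewrite row_edge_col subr_eq0 => /eqP; congr (_ = _); congr (potential _ _ _);
    by apply/rowP => a; rewrite mxE.
have [Ps _ _ _] := section_mxE.
by move=> y_0; rewrite -[w]mulmx1 -Ps mulmxA -/y y_0 mul0mx.
Qed.

Definition response_mx : 'M[R]_q :=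
  Th *m Lap *m Th^T - Th *m Lap *m Pi^T *m invmx quotient_laplacian *m (Pi *m Lap *m Th^T).

Lemma response_mxP (y j : 'cV[R]_q) :
  (exists u : 'cV[R]_(m + q), [/\ port_incidence^T *m u = y, Pi *m Lap *m u = 0
     & j = Th *m Lap *m u]) <-> j = response_mx *m y.
Proof.
have [Ps PD Ts TD] := section_mxE; have uA := quotient_laplacian_unit.
split=> [[u [uy u0 ->]]|->].
(* The transpose of [section_mx] with its factors exchanged, which is allowed since they are
   square. *)
- have uE : u = Pi^T *m (roots_mx^T *m u) + Th^T *m y.
    rewrite -uy !mulmxA -mulmxDl -!trmx_mul -linearD /= -mul_row_col.
    by rewrite (mulmx1C section_mx) trmx1 mul1mx.
  set z := roots_mx^T *m u in uE.
  have zE : z = - (invmx quotient_laplacian *m (Pi *m Lap *m Th^T *m y)).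
    rewrite -mulmxN; apply: (canRL (mulKmx uA)); apply/eqP.
    by rewrite -addr_eq0 -u0 [X in _ == _ *m X]uE mulmxDr !mulmxA.
  by rewrite {1}uE mulmxDr zE /response_mx mulmxBl !mulmxN !mulmxA addrC.
- exists (Th^T *m y - Pi^T *m (invmx quotient_laplacian *m (Pi *m Lap *m Th^T *m y))); split.
  + by rewrite mulmxBr !mulmxA -!trmx_mul PD TD trmx0 !mul0mx trmx1 mul1mx subr0.
  + by rewrite mulmxBr !mulmxA -/quotient_laplacian mulmxV // mul1mx subrr.
  + by rewrite mulmxBr mulmxBl !mulmxA.
Qed.

(** Subtracting the constant [U g] leaves the currents unchanged and removes the ground term from
    the sum. *)
Lemma laplacian_mx_mul (U : V -> R) :
  Lap *m (\col_a (U (vert a) - U g)) = \col_a current G c U (vert a).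
Proof.
apply/colP => a; rewrite !mxE.
have -> : current G c U (vert a) = current G c (fun v => U v - U g) (vert a).
  by rewrite !(currentE c g simpleG); apply: eq_bigr => e _; rewrite opprB addrA subrK.
rewrite /current (sum_enum_off vert_off _ erefl) subrr mulr0 add0r.
by apply: eq_bigr => b _; rewrite !mxE.
Qed.

Lemma blocks_mx_col (I : V -> R) b :
  (Pi *m \col_a I (vert a)) b 0 = \sum_(v | root v == enum_val b) I v.
Proof.
rewrite big_mkcond (sum_enum_off vert_off _ erefl) root_g [g == _]eq_sym.
have [_ ->] := free_rootP b; rewrite add0r mxE; apply: eq_bigr => a _.
by rewrite !mxE; case: eqP; rewrite (mul1r, mul0r).
Qed.

Lemma ports_mx_col (I : V -> R) i : (Th *m \col_a I (vert a)) i 0 = I (x i).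
Proof.
rewrite mxE (bigD1 (rshift m i)) //= !mxE vert_r eqxx mul1r big1 ?addr0 // => a ai.
have [vI _ _] := vert_off; rewrite !mxE; case: eqP => [xi|_]; last by rewrite mul0r.
by move: ai; rewrite -(inj_eq vI) vert_r xi eqxx.
Qed.

Lemma port_incidence_col (U : V -> R) i :
  (port_incidence^T *m \col_a (U (vert a) - U g)) i 0 = U (x i) - U (root (x i)).
Proof.
transitivity ((\row_a (U (vert a) - U g) *m port_incidence) 0 i).
  by rewrite !mxE; apply: eq_bigr => a _; rewrite !mxE mulrC.
rewrite mul_reduced_incidence !(potential_row vert_off) ?inE //=.
by rewrite opprB addrA subrK.
Qed.

Lemma response_mx_spec (y j : 'cV[R]_q) :
  (exists U : V -> R, [/\ forall i, U (x i) - U (root (x i)) = y i 0,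
     forall v, \sum_(w in block_of v) current G c U w = 0
     & j = \col_i current G c U (x i)]) <-> j = response_mx *m y.
Proof.
apply: (iff_trans _ (response_mxP y j)); split=> [[U [Uy U0 ->]]|[u [uy u0 ->]]].
  exists (\col_a (U (vert a) - U g)); rewrite -!mulmxA laplacian_mx_mul; split.
  - by apply/colP => i; rewrite port_incidence_col.
  - apply/colP => b; rewrite blocks_mx_col mxE -[RHS](U0 (enum_val b)).
    by apply: eq_bigl => w; rewrite inE; have [-> _] := free_rootP b.
  - by apply/colP => i; rewrite ports_mx_col mxE.
pose U := potential vert u^T.
have uE : u = \col_a (U (vert a) - U g).
  apply/colP => a; rewrite !mxE /U (potentialE vert_off) (potential_off vert_off).
  by rewrite subr0 mxE.
have free0 (b : 'I_m) : \sum_(v | root v == enum_val b) current G c U v = 0.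
  by rewrite -blocks_mx_col -laplacian_mx_mul -uE mulmxA u0 mxE.
have root0 v : root v != g -> \sum_(w | root w == root v) current G c U w = 0.
  move=> vg; have vf : root v \in free_roots by rewrite inE rootK eqxx.
  by have := free0 (enum_rank_in vf (root v)); rewrite enum_rankK_in.
exists U; split.
- by move=> i; rewrite -port_incidence_col -uE uy.
- move=> v; transitivity (\sum_(w | root w == root v) current G c U w).
    by apply: eq_bigl => w; rewrite inE.
  have [->|vg] := eqVneq (root v) g; last exact: root0.
  (* The total current vanishes and so does its sum over every other block, hence also the sum over
     the block of [g]. *)
  rewrite -[RHS](sum_current c g simpleG U).
  rewrite [RHS](partition_big root (fun w => root w == w)) /= => [|w _]; last by rewrite rootK.
  rewrite [RHS](bigD1 g) ?root_g //= [X in _ + X]big1 ?addr0 //.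
  by move=> w /andP[/eqP rw wg]; rewrite -{1}rw; apply: root0; rewrite rw.
- by rewrite -mulmxA {1}uE laplacian_mx_mul; apply/colP => i; rewrite ports_mx_col mxE.
Qed.

(** * Expansion of determinants over edge sets and forests *)

Definition edge_enum (F : {set {set V}}) l (j : 'I_l) : {set V} := nth set0 (enum F) j.

Lemma edge_enum_inj (F : {set {set V}}) l : #|F| = l -> injective (@edge_enum F l).
Proof.
move=> Fl i j /eqP; rewrite nth_uniq ?enum_uniq -?cardE ?Fl // => /eqP.
exact: val_inj.
Qed.

Lemma edge_enum_im (F : {set {set V}}) l : #|F| = l -> [set @edge_enum F l j | j : 'I_l] = F.
Proof.
move=> Fl; apply/eqP; rewrite eqEcard card_imset ?card_ord ?Fl ?leqnn ?andbT.
  apply/subsetP => _ /imsetP[j _ ->]; rewrite -mem_enum mem_nth // -cardE Fl //.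
exact: edge_enum_inj.
Qed.

Local Notation N := (fun F l => edge_incidence (@edge_enum F l)).

Lemma det_gram l (A B : 'M[R]_(l, m + q)) :
  \det (A *m Lap *m B^T) = \sum_(F : {set {set V}} | (F \subset G) && (#|F| == l))
    weight c F * \det (A *m N F l) * \det (B *m N F l).
Proof.
(* Cauchy-Binet ranges over all sets of subsets of [V]; extending the conductances by 0 discards
   those not contained in [G]. *)
pose c' e := if e \in G then c e else 0.
have -> : A *m Lap *m B^T = \sum_e c' e *: ((A *m edge_col e) *m (B *m edge_col e)^T).
  rewrite laplacian_mxE mulmx_sumr mulmx_suml big_mkcond; apply: eq_bigr => e _.
  rewrite /c'; case: ifP => _; last by rewrite scale0r.
  by rewrite -scalemxAr -scalemxAl trmx_mul !mulmxA.
rewrite (Cauchy_Binet set0) [LHS](bigID (fun F : {set _} => F \subset G)) /=.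
rewrite [X in _ + X]big1 ?addr0 => [|F /andP[_ /subsetPn[e eF /negPf eG]]]; last first.
  by rewrite (bigD1 e) //= /c' eG !mul0r.
apply: eq_big => [F|F /andP[_ /subsetP FG]]; first exact: andbC.
have NE (D : 'M[R]_(l, m + q)) :
    \matrix_(i, j) (D *m edge_col (nth set0 (enum F) j)) i 0 = D *m N F l.
  by apply/matrixP => i j; rewrite !mxE; apply: eq_bigr => a _; rewrite !mxE.
rewrite !NE; congr (_ * _ * _); apply: eq_bigr => e /FG eG.
by rewrite /c' eG.
Qed.

Definition component_mx r (C : 'I_r.+1 -> {set V}) : 'M[R]_(r, m + q) :=
  \matrix_(a, v) (vert v \in C (lift ord0 a))%:R.

Section Forest.
Variables (F : {set {set V}}) (r : nat) (C : 'I_r.+1 -> {set V}).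
Hypotheses (FG : F \subset G) (CF : component_order g F C).
Local Notation Q := (component_mx C).

Let C_in a : C a \in components F.
Proof. by have [_ <- _] := CF; apply: imset_f. Qed.

Let mem_C a v : (v \in C a) = (C a == pblock (components F) v).
Proof. exact: mem_componentE. Qed.

Lemma ground_notin a : (g \in C (lift ord0 a)) = false.
Proof.
have [CI _ g0] := CF; apply/negbTE; move: g0; rewrite !mem_C => /eqP <-.
by rewrite (inj_eq CI) eq_sym neq_lift.
Qed.

Lemma component_mx_mul l (u v : 'I_l -> V) : Q *m reduced_incidence R vert u v =
  \matrix_(a, j) ((u j \in C (lift ord0 a))%:R - (v j \in C (lift ord0 a))%:R).
Proof.
apply: (mul_matrix_incidence vert_off (F := fun a w => (w \in C (lift ord0 a))%:R));
  rewrite ?inE // => a; by rewrite ground_notin.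
Qed.

Variable (l : nat).
Hypothesis Fl : #|F| = l.

Let enum_in (j : 'I_l) : edge_enum F j \in F.
Proof. by have /setP/(_ (edge_enum F j)) <- := edge_enum_im Fl; apply: imset_f. Qed.

Lemma component_mx_edges : Q *m N F l = 0.
Proof.
rewrite component_mx_mul; apply/matrixP => a j; rewrite !mxE /= !mem_C.
by rewrite (comp_edge g simpleG FG (enum_in j)) subrr.
Qed.

(** The columns of [s] are unit vectors at representatives of the components not containing [g]. A
    potential killed by the edges of [F] is constant on components, and one killed by [s] is 0 at
    these representatives. *)
Lemma component_section : exists s : 'M[R]_(m + q, r),
  [/\ incidence_mx s, Q *m s = 1%:M & row_free (row_mx (N F l) s)].
Proof.
have [CI CC _] := CF.
have /fin_all_exists[w wE] (a : 'I_r) := componentP (C_in (lift ord0 a)).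
pose s : 'M[R]_(m + q, r) := reduced_incidence R vert w (fun=> g).
exists s; split; first by apply: reduced_incidence_mx; apply: vert_off.
  rewrite component_mx_mul; apply/matrixP => a b; rewrite !mxE ground_notin subr0.
  by rewrite mem_C -wE (inj_eq CI) (inj_eq lift_inj).
apply: inj_row_free => u; rewrite mul_mx_row -[0]hsubmxK => /eq_row_mx[uN us].
apply: (potential_eq0 vert_off) => v _.
have uconst := connect_const (f := potential vert u) (graph_oriented g simpleG FG) (subxx F).
have {}uconst y z : connect (mg_adj (graph_mg V) F) y z -> potential vert u y = potential vert u z.
  apply: uconst => e; have /setP/(_ e) <- := edge_enum_im Fl => /imsetP[j _ ->].
  apply/eqP; rewrite -subr_eq0.
  have := mul_reduced_incidence vert (h \o @edge_enum F l) (t \o @edge_enum F l) u j => /= <-.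
  by rewrite -/(edge_incidence _) uN linear0 mxE.
have : pblock (components F) v \in [set C a | a : 'I_r.+1] by rewrite CC comp_in.
case/imsetP => a _ va; case: (unliftP ord0 a) va => [b|] -> va.
  rewrite (uconst v (w b)); last by rewrite -eq_compE va wE.
  by apply/eqP; rewrite -subr_eq0 -(mul_reduced_incidence vert w (fun=> g) u b) us linear0 mxE.
have [_ _] := CF; rewrite mem_C -va => /eqP vg.
by apply: uconst; rewrite -eq_compE vg.
Qed.

Let acyclicE : mg_acyclic (graph_mg V) F = row_full (N F l).
Proof.
exact: (acyclic_row_full R vert_off (graph_oriented g simpleG FG) erefl
          (edge_enum_inj Fl) (edge_enum_im Fl)).
Qed.

(** The count of edges and components, obtained from the invertibility of [row_mx (N F l) s]. *)
Lemma acyclic_card : mg_acyclic (graph_mg V) F -> (l + r)%N = (m + q)%N.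
Proof.
rewrite acyclicE => /row_fullP[X XN]; have [s [_ Qs freeN]] := component_section.
have fullN : row_full (row_mx (N F l) s).
  (* The correction by [X *m s *m Q] makes the upper rows vanish on [s]; it does not affect [N], as
     [Q] kills it. *)
  apply/row_fullP; exists (col_mx (X - X *m s *m Q) Q).
  rewrite mul_col_row component_mx_edges Qs !mulmxBl XN -!mulmxA component_mx_edges Qs.
  by rewrite !mulmx0 mulmx1 subr0 subrr -scalar_mx_block.
by move: freeN fullN; rewrite /row_free /row_full => /eqP-> /eqP.
Qed.

Lemma det_neq0_acyclic (A : 'M[R]_(l, m + q)) :
  \det (A *m N F l) != 0 -> mg_acyclic (graph_mg V) F.
Proof.
rewrite acyclicE -unitfE -unitmxE => uAN; apply/row_fullP.
by exists (invmx (A *m N F l) *m A); rewrite -mulmxA mulVmx.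
Qed.

End Forest.

Lemma forests_card (F : {set {set V}}) r l :
  F \in forests G r.+1 -> (l + r)%N = (m + q)%N -> #|F| = l.
Proof.
rewrite inE => /andP[/andP[FG acF] /eqP Fr] lr.
have [r' [C CF]] := component_order_exists g F.
have rr' : r' = r by apply: succn_inj; rewrite -(component_order_card CF).
rewrite rr' in C CF; have := acyclic_card FG CF erefl acF.
by rewrite -lr => /addIn.
Qed.

Lemma det_neq0_forest (F : {set {set V}}) r l (A : 'M[R]_(l, m + q)) : F \subset G -> #|F| = l ->
  (l + r)%N = (m + q)%N -> \det (A *m N F l) != 0 -> F \in forests G r.+1.
Proof.
move=> FG Fl lr dA; have acF := det_neq0_acyclic FG Fl dA.
have [r' [C CF]] := component_order_exists g F.
have := acyclic_card FG CF Fl acF; rewrite -lr => /addnI rr'.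
by rewrite inE /spanning_forest FG acF (component_order_card CF) rr' eqxx.
Qed.

(** The matrix-tree theorem for the contracted network. [Pi *m N F m] is the reduced incidence
    matrix of the quotient, so its squared determinant is 1 for spanning trees and 0 otherwise. *)
Lemma quotient_laplacian_det :
  \det quotient_laplacian = \sum_(F | spanning_forest G F &&
     mg_spanning_tree (quotient_mg [set block_of v | v : V]) F) weight c F.
Proof.
have PiN F : Pi *m N F m = reduced_incidence R (fun b => block_of (enum_val b))
    ((block_of \o h) \o @edge_enum F m) ((block_of \o t) \o @edge_enum F m).
  rewrite blocks_mul; apply/matrixP => b j; rewrite !mxE /=.
  have blockE v : (block_of (enum_val b) == block_of v) = (root v == enum_val b).
    have [rb _] := free_rootP b; apply/eqP/eqP => [/setP/(_ v)|rv].
      by rewrite !inE eqxx rb => /eqP.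
    by apply/setP => w; rewrite !inE rb rv.
  by rewrite !blockE.
have treeE (F : {set {set V}}) : F \subset G -> #|F| = m ->
    mg_spanning_tree (quotient_mg [set block_of v | v : V]) F = (\det (Pi *m N F m) != 0).
  move=> FG Fm; rewrite PiN.
  exact: (spanning_tree_det R (H := quotient_mg _) block_off (block_oriented FG)
            (edge_enum_inj Fm) (edge_enum_im Fm)).
rewrite det_gram (bigID (fun F => mg_spanning_tree (quotient_mg [set block_of v | v : V]) F)) /=.
rewrite [X in _ + X]big1 ?addr0 => [|F /andP[/andP[FG /eqP Fm] ntF]]; last first.
  by move: ntF; rewrite treeE // negbK => /eqP->; rewrite mulr0.
apply: eq_big => [F|F /andP[/andP[FG /eqP Fm] tF]]; last first.
  move: tF; rewrite treeE // => d0; rewrite -mulrA -expr2.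
  rewrite incidence_unit_det ?mulr1 ?unitmxE ?unitfE // PiN.
  by apply: reduced_incidence_mx; apply: block_off.
rewrite /spanning_forest -!andbA; case FG: (F \subset G) => //=.
(* Acyclicity in [G] itself is automatic: a nonzero determinant provides a left inverse of
   [N F m]. *)
apply/andP/andP => [[/eqP Fm tF]|[acF tF]].
  split=> //; apply: (det_neq0_acyclic FG Fm (A := Pi)).
  by rewrite -treeE.
split=> //; apply/eqP.
exact: (spanning_tree_card R block_off (H := quotient_mg _) (block_oriented FG) erefl
         (edge_enum_inj erefl) (edge_enum_im erefl) tF).
Qed.

Lemma minor_response k r (e : (r + k)%N = q) (I J : {set 'I_q}) (hI : #|I| = k) (hJ : #|J| = k)
    (C : {set {set V}} -> 'I_r.+1 -> {set V}) :
    (forall F, F \in forests G r.+1 -> component_order g F (C F)) ->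
  minor response_mx hI hJ = (\det quotient_laplacian)^-1 *
    \sum_(F in forests G r.+1)
      \det (castmx (e, erefl q) (col_mx (component_mx (C F) *m port_incidence) (selE R hI)^T)) *
      \det (castmx (e, erefl q) (col_mx (component_mx (C F) *m port_incidence) (selE R hJ)^T)) *
      weight c F.
Proof.
move=> CF; have uA := quotient_laplacian_unit.
have dA : \det quotient_laplacian != 0 by rewrite -unitfE -unitmxE.
apply: (mulfI dA); rewrite mulrA divff // mul1r.
pose Psi (K : {set 'I_q}) (hK : #|K| = k) := col_mx Pi ((selE R hK)^T *m Th).
have selE_mul (M : 'M[R]_q) : (selE R hI)^T *m M *m selE R hJ = mxsub (elt hI) (elt hJ) M.
  apply/matrixP => a b; rewrite !mxE (bigD1 (elt hJ b)) //= !mxE eqxx mulr1.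
  rewrite (bigD1 (elt hI a)) //= !mxE eqxx mul1r !big1 ?addr0 // => i /negPf ne.
    by rewrite !mxE ne mulr0.
  by rewrite !mxE ne mul0r.
(* Selecting ports commutes with the Schur complement: only the port rows and columns are
   restricted, to [I] and [J]. *)
have -> : \det quotient_laplacian * minor response_mx hI hJ =
    \det (Psi I hI *m Lap *m (Psi J hJ)^T).
  rewrite /Psi tr_col_mx mul_col_mx mul_col_row det_schur // -/quotient_laplacian.
  congr (_ * \det _); rewrite -selE_mul /response_mx mulmxBr mulmxBl trmx_mul trmxK.
  by rewrite !mulmxA.
(* By [acyclic_card], an acyclic set of [m + k] edges has exactly [r.+1] components. *)
have lr : (m + k + r)%N = (m + q)%N by rewrite -e -addnA (addnC k).
rewrite det_gram.
rewrite (bigID (fun F => F \in forests G r.+1)) /= [X in _ + X]big1 ?addr0; last first.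
  move=> F /andP[/andP[FG /eqP Fl]] nF.
  have [->|d0] := eqVneq (\det (Psi I hI *m N F (m + k))) 0; first by rewrite mulr0 mul0r.
  by rewrite (det_neq0_forest FG Fl lr d0) in nF.
apply: eq_big => [F|F /andP[/andP[FG /eqP Fl] Ff]].
  apply: andb_idl => Ff; rewrite (forests_card Ff lr) eqxx.
  by move: Ff; rewrite inE => /andP[/andP[->]].
have [s [incs Qs freeN]] := component_section FG (CF F Ff) Fl.
rewrite -mulrA mulrC; congr (_ * _).
apply: (det_mul_completed e (s := s) section_mx _ Qs _ _ incs freeN).
- exact: component_mx_edges FG (CF F Ff) _ Fl.
- by apply: incidence_row_mx; apply: reduced_incidence_mx; apply: vert_off.
- by apply: reduced_incidence_mx; apply: vert_off.
Qed.

End Network.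

(** * Superports *)

Section Superports.
Variables (R : realFieldType) (V : finType) (G : {set {set V}}) (c : {set V} -> R).
Variables (p q : nat) (A : 'I_p -> {set V}) (rt : 'I_p -> V) (x : 'I_q -> V) (g : V).
Hypothesis A_disjoint : forall a b, a != b -> [disjoint A a & A b].
Hypothesis rt_in : forall a, rt a \in A a.
Hypothesis x_range : [set x i | i : 'I_q] = boundary A :\: port_roots rt.
Hypothesis g_root : g \in port_roots rt.
Local Notation root := (root_of A rt).

Lemma root_of_in a v : v \in A a -> root v = rt a.
Proof.
move=> va; rewrite /root_of; case: pickP => [b vb|/(_ a)]; last by rewrite va.
have [<-//|ab] := eqVneq a b; have /disjoint_setI0/setP/(_ v) := A_disjoint ab.
by rewrite !inE va vb.
Qed.

Lemma root_of_out v : v \notin boundary A -> root v = v.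
Proof.
move=> vA; rewrite /root_of; case: pickP => // a va.
by case/negP: vA; apply/bigcupP; exists a.
Qed.

Lemma root_of_rt a : root (rt a) = rt a.
Proof. exact: root_of_in. Qed.

Lemma boundaryP v : reflect (exists a, v \in A a) (v \in boundary A).
Proof.
by apply: (iffP bigcupP) => [[a _ va]|[a va]]; exists a.
Qed.

Lemma root_ofK v : root (root v) = root v.
Proof.
have [/boundaryP[a va]|vA] := boolP (v \in boundary A); last by rewrite !root_of_out.
by rewrite (root_of_in va) root_of_rt.
Qed.

Lemma root_of_g : root g = g.
Proof. by have /imsetP[a _ ->] := g_root; apply: root_of_rt. Qed.

Lemma x_rangeE v : (v \in [set x i | i : 'I_q]) = (root v != v).
Proof.
rewrite x_range inE; have [/boundaryP[a va]|vA] := boolP (v \in boundary A); last first.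
  by rewrite root_of_out // eqxx andbF.
rewrite andbT (root_of_in va); congr (~~ _); apply/imsetP/eqP => [[b _ vb]|<-]; last by exists a.
by rewrite -(root_of_in va) vb root_of_rt.
Qed.

Lemma block_of_in a v : v \in A a -> block_of root v = A a.
Proof.
move=> va; apply/setP => w; rewrite inE (root_of_in va).
apply/eqP/idP => [wa|/root_of_in//].
have [/boundaryP[b wb]|wA] := boolP (w \in boundary A).
  rewrite (root_of_in wb) in wa; have [->//|ab] := eqVneq a b.
  have /disjoint_setI0/setP/(_ (rt a)) := A_disjoint ab.
  by rewrite !inE rt_in -wa rt_in.
by case/negP: (wA); apply/boundaryP; exists a; rewrite -(root_of_out wA) wa rt_in.
Qed.

Lemma block_of_out v : v \notin boundary A -> block_of root v = [set v].
Proof.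
move=> vA; apply/setP => w; rewrite !inE (root_of_out vA).
have [/boundaryP[b wb]|wA] := boolP (w \in boundary A); last by rewrite root_of_out.
rewrite (root_of_in wb); apply/eqP/eqP => [rv|wv].
  by case/negP: vA; apply/boundaryP; exists b; rewrite -rv.
by case/negP: vA; apply/boundaryP; exists b; rewrite -wv.
Qed.

Lemma port_blocksE : port_blocks A = [set block_of root v | v : V].
Proof.
apply/setP => B; rewrite inE; apply/orP/imsetP => [[]/imsetP[]|[v _ ->]].
- by move=> a _ ->; exists (rt a); rewrite // (block_of_in (rt_in a)).
- by move=> v; rewrite inE => vA ->; exists v; rewrite // block_of_out.
have [/boundaryP[a va]|vA] := boolP (v \in boundary A).
  by left; rewrite (block_of_in va) imset_f.
by right; rewrite block_of_out // imset_f // inE.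
Qed.

(** Vertices off the boundary are singleton blocks, so the two current conditions merge into one. *)
Lemma admissibleE y U : admissible G c A rt x y U <->
  (forall i, U (x i) - U (root (x i)) = y i 0) /\
  (forall v, \sum_(w in block_of root v) current G c U w = 0).
Proof.
split=> [[Uy U0 UA]|[Uy U0]]; split=> //.
- move=> v; have [/boundaryP[a va]|vA] := boolP (v \in boundary A).
    by rewrite (block_of_in va) UA.
  by rewrite block_of_out // big_set1 U0.
- by move=> v vA; rewrite -[RHS](U0 v) block_of_out // big_set1.
- by move=> a; rewrite -(block_of_in (rt_in a)).
Qed.

(** The entries do not depend on how the vertices other than [g] are enumerated, so this product
    over [enum_val] can be compared with one over [vert]. *)
Lemma compBE r (C : 'I_r.+1 -> {set V}) F :
    component_order g F C ->
  compB R A rt x g C = \matrix_(a, i)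
    ((x i \in C (lift ord0 a))%:R - (root (x i) \in C (lift ord0 a))%:R).
Proof.
move=> CF.
have off : @enum_off V _ (fun v : 'I_#|[set~ g]| => enum_val v) g [set: V].
  split=> [|v|]; first exact: enum_val_inj.
    by have := enum_valP v; rewrite !inE.
  apply/setP => v; rewrite !inE; have [//|vg] := eqVneq v g.
  have vI : v \in [set~ g] by rewrite !inE.
  by apply/esym/imsetP; exists (enum_rank_in vI v); rewrite ?enum_rankK_in.
apply: (mul_matrix_incidence off (F := fun a w => (w \in C (lift ord0 a))%:R)
  (h := x) (t := root \o x)); rewrite ?inE // => a.
by rewrite (ground_notin CF).
Qed.

Lemma port_graph_oriented F T : oriented (quotient_port_graph A rt x F) T
  (H_head x F) (H_tail A rt x F).
Proof.
move=> i _; split=> [||B B' _ _]; rewrite ?comp_in //=.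
by rewrite orbC.
Qed.

(** Up to sign, the completed determinant is that of the columns outside [I]. These form the square
    reduced incidence matrix of the quotient port graph with edges [~: I]. *)
Lemma chi_hatE k (I : {set 'I_q}) (hI : #|I| = k) F (C : 'I_(q - k).+1 -> {set V}) :
    component_order g F C ->
  (chi_hat R A rt x g C hI \in [:: 0; 1; -1]) /\
  (chi_hat R A rt x g C hI != 0) = mg_spanning_tree (quotient_port_graph A rt x F) (~: I).
Proof.
move=> CF; have hJ : #|~: I| = (q - k)%N by rewrite cardsCs setCK card_ord hI.
have eltI : injective (elt hJ) by move=> a b /enum_val_inj/cast_ord_inj.
have [eps eps1] := det_completed R (compl_dim hI) hI hJ.
rewrite /chi_hat /stack_det => ->.
have -> : colsub (elt hJ) (compB R A rt x g C) = reduced_incidence R (C \o lift ord0)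
    (H_head x F \o elt hJ) (H_tail A rt x F \o elt hJ).
  apply/matrixP => a j; rewrite mxE (compBE CF) !mxE /=.
  by rewrite !(@mem_componentE _ F) //; have [_ <- _] := CF; rewrite imset_f.
have off := component_order_off CF.
have eps0 : eps != 0 by rewrite -sqrf_eq0 eps1 oner_eq0.
split.
  have := incidence_det
    (reduced_incidence_mx R off (H_head x F \o elt hJ) (H_tail A rt x F \o elt hJ)).
  have: eps \in [:: 1; -1] by rewrite !inE -eqf_sqr expr1n eps1.
  rewrite !inE.
  by case/orP => /eqP-> /or3P[]/eqP->; rewrite ?mulr0 ?mulN1r ?mul1r ?opprK ?eqxx ?orbT.
rewrite mulf_eq0 (negPf eps0) /=.
rewrite (spanning_tree_det R (H := quotient_port_graph A rt x F) off
           (@port_graph_oriented F (~: I)) eltI) //.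
apply/setP => i; apply/imsetP/idP => [[b _ ->]|iI]; first exact: enum_valP.
exists (cast_ord hJ (enum_rank_in iI i)) => //.
by rewrite /elt cast_ordK enum_rankK_in.
Qed.

End Superports.

Theorem theorem5p2 (R : realFieldType) (V : finType) (G : {set {set V}})
    (c : {set V} -> R) (p q : nat) (A : 'I_p -> {set V}) (rt : 'I_p -> V)
    (x : 'I_q -> V) (g : V)
    (G_simple : simple_graph G)
    (G_connected : mg_connected (graph_mg V) G)
    (c_pos : forall e, e \in G -> 0 < c e)
    (A_disjoint : forall a b, a != b -> [disjoint A a & A b])
    (rt_in : forall a, rt a \in A a)
    (x_inj : injective x)
    (x_range : [set x i | i : 'I_q] = boundary A :\: port_roots rt)
    (g_root : g \in port_roots rt) :
  (exists! L : 'M[R]_q, superport_response G c A rt x L) /\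
  forall (L : 'M[R]_q), superport_response G c A rt x L ->
  forall (k : nat) (I J : {set 'I_q}) (hI : #|I| = k) (hJ : #|J| = k)
    (C : {set {set V}} -> 'I_(q - k).+1 -> {set V}),
    (forall F, F \in forests G (q - k).+1 -> component_order g F (C F)) ->
  [/\ minor L hI hJ =
        (Phi_valid G c A)^-1 *
        \sum_(F in forests G (q - k).+1)
           chi_hat R A rt x g (C F) hI * chi_hat R A rt x g (C F) hJ
             * weight c F,
      forall F, F \in forests G (q - k).+1 ->
        alpha R A rt x g (C F) hI hJ \in [:: 0; 1; -1]
    & forall F, F \in forests G (q - k).+1 ->
        alpha R A rt x g (C F) hI hJ != 0 <->
        mg_spanning_tree (quotient_port_graph A rt x F) (~: I) /\
        mg_spanning_tree (quotient_port_graph A rt x F) (~: J)].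
Proof.
have rootK := root_ofK A_disjoint rt_in; have rg := root_of_g A_disjoint rt_in g_root.
have xP := x_rangeE A_disjoint rt_in x_range.
have admE := admissibleE G c x A_disjoint rt_in.
pose L0 := response_mx G c (root_of A rt) x g.
have specL0 y j : (exists2 U, admissible G c A rt x y U & j = \col_i current G c U (x i))
    <-> j = L0 *m y.
  apply: (iff_trans _ (response_mx_spec G_simple G_connected c_pos rootK rg x_inj xP y j)).
  split=> [[U /admE[Uy U0] ->]|[U [Uy U0 ->]]]; exists U => //.
  exact/admE.
have uniqL L : superport_response G c A rt x L -> L0 = L.
  move=> specL; suff mulL (y : 'cV[R]_q) : L0 *m y = L *m y.
    (* Equality is tested column by column, on the standard basis vectors. *)
    by apply/trmx_inj/row_matrixP => i; rewrite -!tr_col !colE !mulL.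
  by apply/(specL y (L0 *m y))/specL0.
split; first by exists L0; split.
move=> L /uniqL <- k I J hI hJ C CF.
have chiP (K : {set 'I_q}) (hK : #|K| = k) F (Ff : F \in forests G (q - k).+1) :=
  chi_hatE R A rt x hK (CF F Ff).
split.
- rewrite (minor_response G_simple G_connected c_pos rootK rg x_inj xP (compl_dim hI) hI hJ CF).
  rewrite (quotient_laplacian_det c G_simple rootK rg x_inj xP) -port_blocksE //.
  congr (_ * _); apply: eq_bigr => F Ff.
  have BE : component_mx R (root_of A rt) x g (C F) *m port_incidence R (root_of A rt) x g =
      compB R A rt x g (C F).
    by rewrite (component_mx_mul R rootK rg x_inj xP (CF F Ff)) (compBE R A rt x (CF F Ff)).
  rewrite /chi_hat /stack_det -BE; congr (_ * \det _ * _).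
  (* The determinant for [J] is cast along [compl_dim hI] on one side and along [compl_dim hJ] on
     the other. *)
  by congr castmx; congr pair; apply: eq_irrelevance.
- move=> F Ff; have [+ _] := chiP I hI F Ff; have [+ _] := chiP J hJ F Ff.
  rewrite /alpha !inE => /or3P[]/eqP-> /or3P[]/eqP->;
  by rewrite ?mulr0 ?mul0r ?mulN1r ?mul1r ?opprK ?eqxx ?orbT.
- move=> F Ff; have [_ <-] := chiP I hI F Ff; have [_ <-] := chiP J hJ F Ff.
  by rewrite /alpha mulf_eq0 negb_or; split=> /andP.
Qed.
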